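(* Let $\Lambda = K\mathcal{Q}/I$ be a finite dimensional algebra over a field $K$, where $I$ is an admissible ideal of $K\mathcal{Q}$ with minimal generating set $f^2$ (consisting of uniform elements), and fix a length-lexicographic order on the paths of $\mathcal{Q}$. Suppose that for all $(v,w) \in \mathrm{Bdy}(f^2)$ either $v\Lambda w = \{0\}$ or there is some path $p$ such that $v\,\mathrm{NonTip}(I)\,w = \{p\}$. In the case where $v\Lambda w \neq \{0\}$ suppose further that $vf^2w = \{p - q_1, \ldots, p - q_t\}$ for paths $q_1, \ldots, q_t$. Thus we may write $\mathcal{G}^2 = \{p_1, \ldots, p_r\}$, where for each $i = 1, \ldots, r$ we have non-zero paths $q_{i1}, \ldots, q_{it_i}$ with $\mathfrak{o}(p_i) f^2 \mathfrak{t}(p_i) = \{p_i - q_{i1}, \ldots, p_i - q_{it_i}\}$. Let $Y = \{p_1, \ldots, p_r\} \cup \{q_{ij} \mid 1 \leq i \leq r,\ 1 \leq j \leq t_i\}$. Suppose that $L_0(Y) = Y$. Let $a_{ij}$ be an arrow associated to $q_{ij}$ and assume that $a_{ij}$ occurs only once in the path $q_{ij}$. Then every element of $\mathrm{Hom}(Q^2, \Lambda)$ is a coboundary, that is, $\phi_{p,x} \in \mathrm{Im}\, d_2$ for all $p \in \mathcal{G}^2$ and $x \in f^2$ with $\mathfrak{o}(x) = \mathfrak{o}(p)$ and $\mathfrak{t}(x) = \mathfrak{t}(p)$, and thus $\mathrm{HH}^2(\Lambda) = 0$.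
   Context: Paths are written from left to right. For an arrow, path or uniform element $x$ (a linear combination of paths all with the same start vertex and the same end vertex), $\mathfrak{o}(x)$ and $\mathfrak{t}(x)$ denote its start and end vertex. Vertices are identified with the corresponding idempotents; $vf^2w$ is the set of elements $x\in f^2$ with $\mathfrak o(x)=v$, $\mathfrak t(x)=w$. Length-lexicographic order: fix a linear order on the vertices and on the arrows; every vertex is smaller than every path of length at least one; longer paths are larger than shorter ones; paths of equal positive length are compared lexicographically from the left. For $0\ne f \in K\mathcal{Q}$, $\mathrm{tip}(f)$ is the largest path occurring in $f$ with non-zero coefficient; $\mathrm{Tip}(I) = \{\mathrm{tip}(f) \mid f \in I\setminus\{0\}\}$, and $\mathrm{NonTip}(I)$ is the set of paths not in $\mathrm{Tip}(I)$. For vertices $v,w$, $v\,\mathrm{NonTip}(I)\,w$ is the set of paths in $\mathrm{NonTip}(I)$ from $v$ to $w$; it is a $K$-basis of $v\Lambda w$. $\mathrm{Bdy}(f^2) = \{(\mathfrak{o}(x), \mathfrak{t}(x)) \mid x \in f^2\}$, and $\mathcal{G}^2 = \bigcup_{(v,w)\in \mathrm{Bdy}(f^2)} v\,\mathrm{NonTip}(I)\,w$. For a set $X$ of paths, $L_0(X)$ is the set of $p \in X$ such that there exists an arrow $a$ which occurs in $p$ and does not occur in any element of $X \setminus\{p\}$; such an $a$ is called an arrow associated to $p$. The beginning of the minimal projective $\Lambda,\Lambda$-bimodule resolution of $\Lambda$ is $Q^2 \xrightarrow{A_2} Q^1 \xrightarrow{A_1} Q^0 \to \Lambda \to 0$ with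 (tensor products over $K$) $Q^0 = \bigoplus_{v \text{ vertex}} \Lambda v\otimes v\Lambda$, $Q^1 = \bigoplus_{a \text{ arrow}} \Lambda\mathfrak{o}(a)\otimes\mathfrak{t}(a)\Lambda$, $Q^2 = \bigoplus_{x\in f^2}\Lambda\mathfrak{o}(x)\otimes\mathfrak{t}(x)\Lambda$. For $x = \sum_j c_j a_{1j}\cdots a_{s_jj} \in f^2$ ($c_j\in K$, $a_{kj}$ arrows), $A_2$ sends the generator $\mathfrak{o}(x)\otimes\mathfrak{t}(x)$ to $\sum_j c_j \sum_{k=1}^{s_j} a_{1j}\cdots a_{(k-1)j}\otimes a_{(k+1)j}\cdots a_{s_jj}$, where the $k$-th term lies in the summand $\Lambda\mathfrak{o}(a_{kj})\otimes\mathfrak{t}(a_{kj})\Lambda$. Here $\mathrm{Hom}$ means $\Lambda,\Lambda$-bimodule homomorphisms, and $d_2:\mathrm{Hom}(Q^1,\Lambda)\to\mathrm{Hom}(Q^2,\Lambda)$ is $f\mapsto fA_2$. $\mathrm{HH}^2(\Lambda)$ is the second Hochschild cohomology group of $\Lambda$ with coefficients in $\Lambda$. For $p\in\mathcal{G}^2$ and $x\in f^2$ with $\mathfrak{o}(x)=\mathfrak{o}(p)$ and $\mathfrak{t}(x)=\mathfrak{t}(p)$, $\phi_{p,x}: Q^2\to\Lambda$ is the bimodule homomorphism sending the generator $\mathfrak{o}(x)\otimes\mathfrak{t}(x)$ of the summand indexed by $x$ to $p$ and the generators of all other summands to $0$. *)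

(* Defs.v *)
From HB Require Import structures.
From mathcomp Require Import all_boot all_algebra.
From mathcomp Require Import finmap monalg.
From mathcomp Require Import boolp classical_sets.

Set Implicit Arguments.
Unset Strict Implicit.
Unset Printing Implicit Defensive.

Import GRing.Theory.
Import Quotient.
Local Open Scope ring_scope.
Local Open Scope classical_set_scope.
Local Open Scope quotient_scope.

Section LinearExtension.
Variables (K : fieldType) (G : choiceType) (W : lmodType K).

Definition mlin (h : G -> W) (f : {malg K[G]}) : W :=
  \sum_(k <- msupp f) f@_k *: h k.

Lemma mlinEw (h : G -> W) (f : {malg K[G]}) (d : {fset G}) :
  (msupp f `<=` d)%fset -> mlin h f = \sum_(k <- d) f@_k *: h k.
Proof.
move=> fd; rewrite /mlin (big_fset_incl _ fd) //= => k _ kf.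
by rewrite mcoeff_outdom // scale0r.
Qed.

Lemma mlin_is_linear (h : G -> W) : linear (mlin h).
Proof.
move=> c f g; pose d := (msupp f `|` msupp g `|` msupp (c *: f + g))%fset.
have sub2 : (msupp (c *: f + g) `<=` d)%fset by apply: fsubsetUr.
have subf : (msupp f `<=` d)%fset by rewrite /d -fsetUA; apply: fsubsetUl.
have subg : (msupp g `<=` d)%fset.
  by rewrite /d; apply/fsubsetP => k kg; rewrite !inE kg orbT.
rewrite (mlinEw _ sub2) (mlinEw _ subf) (mlinEw _ subg).
rewrite scaler_sumr -big_split /=; apply: eq_bigr => k _.
by rewrite mcoeffD mcoeffZ scalerDl scalerA.
Qed.

HB.instance Definition _ (h : G -> W) :=
  GRing.isLinear.Build K {malg K[G]} W *:%R (mlin h) (mlin_is_linear h).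

Lemma mlinU (h : G -> W) k : mlin h << k >> = h k.
Proof. by rewrite /mlin msuppU oner_eq0 big_seq_fset1 mcoeffUU scale1r. Qed.

Lemma malg_linear_ext (f g : {linear {malg K[G]} -> W}) :
  (forall k, f << k >> = g << k >>) -> f =1 g.
Proof.
move=> fg x; rewrite [x]monalgE !linear_sum /=; apply: eq_bigr => k _.
have -> : << x@_k *g k >> = x@_k *: << k >> :> {malg K[G]}.
  by apply/malgP => j; rewrite mcoeffZ !mcoeffU mulr_natr.
by rewrite !linearZ /= fg.
Qed.

Lemma malg_linear_extP (f g : {malg K[G]} -> W) :
  linear f -> linear g -> (forall k, f << k >> = g << k >>) -> f =1 g.
Proof.
move=> lf lg fg.
pose Lf := GRing.isLinear.Build K {malg K[G]} W *:%R f lf.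
pose Lg := GRing.isLinear.Build K {malg K[G]} W *:%R g lg.
pose Ff : {linear {malg K[G]} -> W} := HB.pack f Lf.
pose Fg : {linear {malg K[G]} -> W} := HB.pack g Lg.
exact: (@malg_linear_ext Ff Fg).
Qed.

End LinearExtension.

Record subspace (K : fieldType) (V : lmodType K) := Subspace {
  subspace_pred :> {pred V};
  subspaceP : submod_closed subspace_pred
}.

Section SubspaceClosed.
Variables (K : fieldType) (V : lmodType K) (W : subspace V).

HB.instance Definition _ :=
  GRing.isZmodClosed.Build V (subspace_pred W) (GRing.submod_closedB (subspaceP W)).

Fact subspace_scale : GRing.scaler_closed (subspace_pred W).
Proof. by move=> c x xW; rewrite -[_ *: _]addr0 (subspaceP W).2 ?rpred0. Qed.

HB.instance Definition _ :=
  GRing.isScaleClosed.Build K V (subspace_pred W) subspace_scale.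

End SubspaceClosed.

Section QuotientSpace.
Variables (K : fieldType) (V : lmodType K) (W : subspace V).

Definition quot_space : Type := quot (subspace_pred W : zmodClosed V).

HB.instance Definition _ := GRing.Zmodule.on quot_space.

Definition spi (x : V) : quot_space :=
  \pi_(quot (subspace_pred W : zmodClosed V)) x.

Lemma spi_eqE (x y : V) : (spi x == spi y) = (x - y \in W).
Proof. by rewrite -idealrBE. Qed.

Lemma spi_surj (x : quot_space) : exists v, x = spi v.
Proof. by exists (repr x); rewrite /spi reprK. Qed.

Fact spi_is_zmod_morphism : zmod_morphism spi.
Proof. exact: pi_is_zmod_morphism. Qed.

HB.instance Definition _ :=
  GRing.isZmodMorphism.Build V quot_space spi spi_is_zmod_morphism.

Definition scaleq (c : K) (x : quot_space) : quot_space := spi (c *: repr x).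

Lemma scaleq_pi c x : scaleq c (spi x) = spi (c *: x).
Proof.
apply/eqP; rewrite /scaleq spi_eqE -scalerBr rpredZ //.
by rewrite -spi_eqE /spi reprK.
Qed.

Fact scaleqA a b x : scaleq a (scaleq b x) = scaleq (a * b) x.
Proof. by have [v ->] := spi_surj x; rewrite !scaleq_pi scalerA. Qed.

Fact scaleq1 : left_id 1 scaleq.
Proof. by move=> x; have [v ->] := spi_surj x; rewrite !scaleq_pi scale1r. Qed.

Fact scaleqDr : right_distributive scaleq +%R.
Proof.
move=> a x y; have [v ->] := spi_surj x; have [w ->] := spi_surj y.
by rewrite -raddfD !scaleq_pi scalerDr raddfD.
Qed.

Fact scaleqDl x : {morph scaleq^~ x : a b / a + b}.
Proof.
by move=> a b; have [v ->] := spi_surj x; rewrite !scaleq_pi scalerDl raddfD.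
Qed.

HB.instance Definition _ := GRing.Zmodule_isLmodule.Build K quot_space
  scaleqA scaleq1 scaleqDr scaleqDl.

Fact spi_is_linear : linear spi.
Proof. by move=> c x y; rewrite raddfD /= -scaleq_pi. Qed.

HB.instance Definition _ :=
  GRing.isLinear.Build K V quot_space *:%R spi spi_is_linear.

End QuotientSpace.

(* As for [idealr], ideals are proper, so that the quotient is an [algType],
   which is nonzero by definition. *)
Record alg_ideal (K : fieldType) (A : algType K) := AlgIdeal {
  ideal_pred :> {pred A};
  ideal_zmod : zmod_closed ideal_pred;
  ideal_1 : 1 \notin ideal_pred;
  ideal_mull : forall a u, u \in ideal_pred -> a * u \in ideal_pred;
  ideal_mulr : forall a u, u \in ideal_pred -> u * a \in ideal_pred
}.

Section QuotientAlgebra.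
Variables (K : fieldType) (A : algType K) (I : alg_ideal A).

Fact ideal_submod : submod_closed (ideal_pred I).
Proof.
have [I0 IB] := ideal_zmod I; split=> // c x y xI yI.
have ID u v : u \in ideal_pred I -> v \in ideal_pred I -> u + v \in ideal_pred I.
  by move=> uI vI; rewrite -[v]opprK IB // -[- v]sub0r IB.
by apply: ID => //; rewrite -mulr_algl ideal_mull.
Qed.

Definition ideal_subspace : subspace A := Subspace ideal_submod.

Definition quot_alg : Type := quot_space ideal_subspace.

HB.instance Definition _ := GRing.Lmodule.on quot_alg.

Definition qpi : A -> quot_alg := @spi K A ideal_subspace.

HB.instance Definition _ := GRing.Linear.on qpi.

Lemma qpi_eqE (x y : A) : (qpi x == qpi y) = (x - y \in I).
Proof. exact: spi_eqE. Qed.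

Lemma qpi_surj (x : quot_alg) : exists a, x = qpi a.
Proof. exact: spi_surj. Qed.

Definition mulq (x y : quot_alg) : quot_alg := qpi (repr x * repr y).

Lemma mulq_pi x y : mulq (qpi x) (qpi y) = qpi (x * y).
Proof.
rewrite /mulq; set x' := repr _; set y' := repr _; apply/eqP; rewrite qpi_eqE.
have xI : x' - x \in I by rewrite -qpi_eqE /qpi /spi reprK.
have yI : y' - y \in I by rewrite -qpi_eqE /qpi /spi reprK.
have -> : x' * y' - x * y = x' * (y' - y) + (x' - x) * y.
  by rewrite mulrBr mulrBl addrA subrK.
by apply: (@rpredD _ (subspace_pred ideal_subspace)); [apply: ideal_mull | apply: ideal_mulr].
Qed.

Fact mulqA : associative mulq.
Proof.
move=> x y z; have [a ->] := qpi_surj x; have [b ->] := qpi_surj y.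
by have [c ->] := qpi_surj z; rewrite !mulq_pi mulrA.
Qed.

Fact mul1q : left_id (qpi 1) mulq.
Proof. by move=> x; have [a ->] := qpi_surj x; rewrite mulq_pi mul1r. Qed.

Fact mulq1 : right_id (qpi 1) mulq.
Proof. by move=> x; have [a ->] := qpi_surj x; rewrite mulq_pi mulr1. Qed.

Fact mulqDl : left_distributive mulq +%R.
Proof.
move=> x y z; have [a ->] := qpi_surj x; have [b ->] := qpi_surj y.
by have [c ->] := qpi_surj z; rewrite -raddfD !mulq_pi mulrDl raddfD.
Qed.

Fact mulqDr : right_distributive mulq +%R.
Proof.
move=> x y z; have [a ->] := qpi_surj x; have [b ->] := qpi_surj y.
by have [c ->] := qpi_surj z; rewrite -raddfD !mulq_pi mulrDr raddfD.
Qed.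

Fact oneq_neq0 : qpi 1 != 0.
Proof. by rewrite -(raddf0 qpi) qpi_eqE subr0 ideal_1. Qed.

HB.instance Definition _ := GRing.Zmodule_isNzRing.Build quot_alg
  mulqA mul1q mulq1 mulqDl mulqDr oneq_neq0.

Lemma qpiM x y : qpi x * qpi y = qpi (x * y).
Proof. exact: mulq_pi. Qed.

Lemma qpiZ c x : qpi (c *: x) = c *: qpi x.
Proof. by rewrite linearZ. Qed.

Fact scaleqAl (c : K) (x y : quot_alg) : c *: (x * y) = c *: x * y.
Proof.
have [a ->] := qpi_surj x; have [b ->] := qpi_surj y.
by rewrite qpiM -!qpiZ qpiM scalerAl.
Qed.

HB.instance Definition _ :=
  GRing.Lmodule_isLalgebra.Build K quot_alg scaleqAl.

Fact scaleqAr (c : K) (x y : quot_alg) : c *: (x * y) = x * (c *: y).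
Proof.
have [a ->] := qpi_surj x; have [b ->] := qpi_surj y.
by rewrite qpiM -!qpiZ qpiM scalerAr.
Qed.

HB.instance Definition _ :=
  GRing.Lalgebra_isAlgebra.Build K quot_alg scaleqAr.

Fact qpi_is_monoid_morphism : monoid_morphism qpi.
Proof. by split=> // x y; rewrite qpiM. Qed.

HB.instance Definition _ :=
  GRing.isMonoidMorphism.Build A quot_alg qpi qpi_is_monoid_morphism.

End QuotientAlgebra.

Definition bilin (K : fieldType) (U V W : lmodType K) (f : U -> V -> W) : Prop :=
  (forall v, linear (f^~ v)) /\ (forall u, linear (f u)).

Section BilinTheory.
Variables (K : fieldType) (U V W : lmodType K) (f : U -> V -> W).
Hypothesis fB : bilin f.

Lemma bilin0l v : f 0 v = 0.
Proof. by have := fB.1 v (-1) 0 0; rewrite scaler0 addr0 scaleN1r addNr. Qed.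

Lemma bilin0r u : f u 0 = 0.
Proof. by have := fB.2 u (-1) 0 0; rewrite scaler0 addr0 scaleN1r addNr. Qed.

Lemma bilinZl c u v : f (c *: u) v = c *: f u v.
Proof. by have := fB.1 v c u 0; rewrite bilin0l !addr0. Qed.

Lemma bilinZr c u v : f u (c *: v) = c *: f u v.
Proof. by have := fB.2 u c v 0; rewrite bilin0r !addr0. Qed.

Lemma bilinDl u u' v : f (u + u') v = f u v + f u' v.
Proof. by have := fB.1 v 1 u u'; rewrite !scale1r. Qed.

Lemma bilinDr u v v' : f u (v + v') = f u v + f u v'.
Proof. by have := fB.2 u 1 v v'; rewrite !scale1r. Qed.

End BilinTheory.

Lemma linear_combine (K : fieldType) (U V : lmodType K) (f g : U -> V) (c : K) :
  linear f -> linear g -> linear (fun x => c *: f x + g x).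
Proof.
by move=> lf lg k x y; rewrite lf lg !scalerDr !scalerA (mulrC c) addrACA.
Qed.

Lemma linear_comp (K : fieldType) (U V W : lmodType K) (f : V -> W) (g : U -> V) :
  linear f -> linear g -> linear (f \o g).
Proof. by move=> lf lg k x y; rewrite /= lg lf. Qed.

Lemma linear_id (K : fieldType) (U : lmodType K) : linear (@id U).
Proof. by []. Qed.

Section Tensor.
Variables (K : fieldType) (U V : lmodType K).
Local Notation free := {malg K[(U * V)%type]}.

Definition tens_rel : set free :=
  [set r | (exists c u u' v, r = << (c *: u + u', v) >>
                               - (c *: << (u, v) >> + << (u', v) >>)) \/
           (exists c u v v', r = << (u, c *: v + v') >>
                               - (c *: << (u, v) >> + << (u, v') >>))].

Definition is_subspace (S : set free) : Prop :=
  S 0 /\ forall (c : K) x y, S x -> S y -> S (c *: x + y).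

Definition tens_ker : {pred free} :=
  [pred x | `[< smallest is_subspace tens_rel x >]].

Fact tens_ker_submod : submod_closed tens_ker.
Proof.
split; first by apply/asboolP => S [[S0 _] _].
move=> c x y /asboolP xS /asboolP yS; apply/asboolP => S SC.
by case: (SC) => -[_ SD] _; apply: SD; [apply: xS | apply: yS].
Qed.

Definition tens : Type := quot_space (Subspace tens_ker_submod).

HB.instance Definition _ := GRing.Lmodule.on tens.

Definition pure_def (u : U) (v : V) : tens :=
  @spi K _ (Subspace tens_ker_submod) << (u, v) >>.
Fact pure_key : unit. Proof. exact: tt. Qed.
Definition pure : U -> V -> tens := locked_with pure_key pure_def.
Canonical pure_unlockable := [unlockable fun pure].

Lemma bilin_pure : bilin pure.
Proof.
split=> [v | u] c x y; rewrite unlock /pure_def -linearP; apply/eqP; rewrite spi_eqE;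
  apply/asboolP => S [_]; apply; [left | right];
  by do 4 eexists.
Qed.

Section Lift.
Variables (W : lmodType K) (f : U -> V -> W).

(* The linear map u (x) v |-> f u v when f is bilinear. *)
Definition tlift_def (t : tens) : W :=
  mlin (fun p : U * V => f p.1 p.2) (repr t).
Fact tlift_key : unit. Proof. exact: tt. Qed.
Definition tlift : tens -> W := locked_with tlift_key tlift_def.
Canonical tlift_unlockable := [unlockable fun tlift].

Hypothesis fB : bilin f.

Local Notation F := (mlin (fun p : U * V => f p.1 p.2)).

Lemma tens_ker_lift x : x \in tens_ker -> F x = 0.
Proof.
move=> /asboolP/(_ [set x | F x = 0]); apply; split.
  split=> [|c y z y0 z0]; first by rewrite /= linear0.
  by move: y0 z0 => /= y0 z0; rewrite mlin_is_linear y0 z0 scaler0 addr0.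
move=> _ [[c [u [u' [v ->]]]] | [c [u [v [v' ->]]]]] /=;
  rewrite linearB linearD linearZ /= !mlinU /=.
  by rewrite fB.1 subrr.
by rewrite fB.2 subrr.
Qed.

Lemma tlift_spi x : tlift (@spi K _ (Subspace tens_ker_submod) x) = F x.
Proof.
rewrite unlock /tlift_def; apply/eqP; rewrite -subr_eq0 -linearB /=; apply/eqP/tens_ker_lift.
by rewrite -[_ \in _](@spi_eqE K _ (Subspace tens_ker_submod)) /spi reprK.
Qed.

Lemma tlift_pure u v : tlift (pure u v) = f u v.
Proof. by rewrite [pure]unlock tlift_spi mlinU. Qed.

Lemma tlift_is_linear : linear tlift.
Proof.
move=> c x y; have [a ->] := spi_surj x; have [b ->] := spi_surj y.
by rewrite -linearP !tlift_spi linearP.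
Qed.

End Lift.

Lemma tens_linear_ext (W : lmodType K) (f g : tens -> W) :
  linear f -> linear g ->
  (forall u v, f (pure u v) = g (pure u v)) -> f =1 g.
Proof.
move=> lf lg fg t; have [a ->] := spi_surj t.
pose f' := f \o @spi K _ (Subspace tens_ker_submod).
pose g' := g \o @spi K _ (Subspace tens_ker_submod).
have lf' : linear f' by move=> c x y; rewrite /f' /= linearP lf.
have lg' : linear g' by move=> c x y; rewrite /g' /= linearP lg.
apply: (@malg_linear_extP K _ W f' g') => // -[u v].
by move: (fg u v); rewrite unlock.
Qed.

End Tensor.

HB.mixin Record Lmodule_isBimodule (K : fieldType) (A : algType K) M
    of GRing.Lmodule K M := {
  lact : A -> M -> M;
  ract : M -> A -> M;
  lactB : bilin lact;
  ractB : bilin ract;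
  lact1 : forall m, lact 1 m = m;
  ract1 : forall m, ract m 1 = m;
  lactM : forall a b m, lact (a * b) m = lact a (lact b m);
  ractM : forall m a b, ract m (a * b) = ract (ract m a) b;
  lractA : forall a m b, ract (lact a m) b = lact a (ract m b)
}.

#[short(type="bimodType")]
HB.structure Definition Bimodule (K : fieldType) (A : algType K) :=
  {M of GRing.Lmodule K M & Lmodule_isBimodule K A M}.

Definition bimod_hom (K : fieldType) (A : algType K) (M N : bimodType A) :
    set (M -> N) :=
  [set f | [/\ linear f,
               forall (a : A) m, f (lact a m) = lact a (f m) &
               forall m (a : A), f (ract m a) = ract (f m) a]].

Section RegularBimodule.
Variables (K : fieldType) (A : algType K).

Definition reg_bimod : Type := A.

HB.instance Definition _ := GRing.Lmodule.on reg_bimod.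

Fact mul_bilin : bilin (@GRing.mul A).
Proof.
by split=> [y | x] c u v; [rewrite mulrDl scalerAl | rewrite mulrDr scalerAr].
Qed.

HB.instance Definition _ := @Lmodule_isBimodule.Build K A reg_bimod
  (@GRing.mul A) (@GRing.mul A) mul_bilin mul_bilin
  (@mul1r A) (@mulr1 A) (fun a b m => esym (mulrA a b m)) (@mulrA A)
  (fun a m b => esym (mulrA a m b)).

End RegularBimodule.

Section Hochschild.
Variables (K : fieldType) (A : algType K).

Definition hoch_d1 (g : A -> A) (a b : A) : A := a * g b - g (a * b) + g a * b.

Definition hoch_d2 (f : A -> A -> A) (a b c : A) : A :=
  a * f b c - f (a * b) c + f a (b * c) - f a b * c.

Definition HH2_cocycle (f : A -> A -> A) : Prop :=
  bilin f /\ forall a b c, hoch_d2 f a b c = 0.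

Definition HH2_coboundary (f : A -> A -> A) : Prop :=
  exists2 g : A -> A, linear g & forall a b, f a b = hoch_d1 g a b.

(* The degree 2 cohomology of the complex Hom_K(A^{(x) n}, A). *)
Definition HH2_eq0 : Prop := forall f, HH2_cocycle f -> HH2_coboundary f.

End Hochschild.

Section ProjectiveBimodule.
Variables (K : fieldType) (A : algType K).

(* The left ideal Ae and the right ideal eA. *)
Definition left_ideal_pred (e : A) : {pred A} :=
  [pred x | `[< exists a, x = a * e >]].
Definition right_ideal_pred (e : A) : {pred A} :=
  [pred x | `[< exists a, x = e * a >]].

Fact left_ideal_submod e : submod_closed (left_ideal_pred e).
Proof.
split=> [|c x y /asboolP[a ->] /asboolP[b ->]]; apply/asboolP.
  by exists 0; rewrite mul0r.
by exists (c *: a + b); rewrite mulrDl scalerAl.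
Qed.

Fact right_ideal_submod e : submod_closed (right_ideal_pred e).
Proof.
split=> [|c x y /asboolP[a ->] /asboolP[b ->]]; apply/asboolP.
  by exists 0; rewrite mulr0.
by exists (c *: a + b); rewrite mulrDr scalerAr.
Qed.

HB.instance Definition _ e :=
  GRing.isSubmodClosed.Build K A (left_ideal_pred e) (left_ideal_submod e).
HB.instance Definition _ e :=
  GRing.isSubmodClosed.Build K A (right_ideal_pred e) (right_ideal_submod e).

Definition lideal (e : A) : Type := {x : A | x \in left_ideal_pred e}.
Definition rideal (e : A) : Type := {x : A | x \in right_ideal_pred e}.

HB.instance Definition _ e := SubChoice.on (lideal e).
HB.instance Definition _ e := [SubChoice_isSubLmodule of lideal e by <:].
HB.instance Definition _ e := SubChoice.on (rideal e).
HB.instance Definition _ e := [SubChoice_isSubLmodule of rideal e by <:].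

Fact left_idealM e a x : x \in left_ideal_pred e -> a * x \in left_ideal_pred e.
Proof.
by move=> /asboolP[b ->]; apply/asboolP; exists (a * b); rewrite mulrA.
Qed.

Fact right_idealM e a x :
  x \in right_ideal_pred e -> x * a \in right_ideal_pred e.
Proof.
by move=> /asboolP[b ->]; apply/asboolP; exists (b * a); rewrite mulrA.
Qed.

Fact left_ideal_mem e a : a * e \in left_ideal_pred e.
Proof. by apply/asboolP; exists a. Qed.

Fact right_ideal_mem e a : e * a \in right_ideal_pred e.
Proof. by apply/asboolP; exists a. Qed.

Definition lmull e (a : A) (l : lideal e) : lideal e :=
  Sub (a * val l) (left_idealM a (valP l)).
Definition rmulr e (r : rideal e) (a : A) : rideal e :=
  Sub (val r * a) (right_idealM a (valP r)).

(* [lproj e] and [rproj f] are the identity on Ae and fA when e and f are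
   idempotent. *)
Definition lproj e (a : A) : lideal e := Sub (a * e) (left_ideal_mem e a).
Definition rproj e (a : A) : rideal e := Sub (e * a) (right_ideal_mem e a).

Fact lmull_bilin e : bilin (@lmull e).
Proof.
by split=> [l | a] c x y; apply: val_inj;
  [rewrite /= mulrDl scalerAl | rewrite /= mulrDr scalerAr].
Qed.

Fact rmulr_bilin e : bilin (@rmulr e).
Proof.
by split=> [l | a] c x y; apply: val_inj;
  [rewrite /= mulrDl scalerAl | rewrite /= mulrDr scalerAr].
Qed.

Variables e f : A.

Definition proj_bimod : Type := tens (lideal e) (rideal f).

HB.instance Definition _ := GRing.Lmodule.on proj_bimod.

Definition plact (a : A) (t : proj_bimod) : proj_bimod :=
  tlift (fun l r => pure (lmull a l) r) t.

Definition pract (t : proj_bimod) (a : A) : proj_bimod :=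
  tlift (fun l r => pure l (rmulr r a)) t.

Fact plact_aux a : bilin (fun (l : lideal e) (r : rideal f) => pure (lmull a l) r).
Proof.
split=> [r | l] c x y; last exact: (bilin_pure _ _).2.
by rewrite (lmull_bilin e).2 (bilin_pure _ _).1.
Qed.

Fact pract_aux a : bilin (fun (l : lideal e) (r : rideal f) => pure l (rmulr r a)).
Proof.
split=> [r | l] c x y; first exact: (bilin_pure _ _).1.
by rewrite (rmulr_bilin f).1 (bilin_pure _ _).2.
Qed.

Lemma plact_pure a l r : plact a (pure l r) = pure (lmull a l) r.
Proof. exact: tlift_pure (plact_aux a) l r. Qed.

Lemma pract_pure a l r : pract (pure l r) a = pure l (rmulr r a).
Proof. exact: tlift_pure (pract_aux a) l r. Qed.

Fact plact_linear a : linear (plact a).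
Proof. exact: tlift_is_linear (plact_aux a). Qed.

Fact pract_linear a : linear (pract^~ a).
Proof. exact: tlift_is_linear (pract_aux a). Qed.

Fact plactB : bilin plact.
Proof.
split=> [t | a]; last exact: plact_linear.
move=> c a b; move: t.
apply: tens_linear_ext => [||l r]; first exact: plact_linear.
  by apply: linear_combine; exact: plact_linear.
by rewrite !plact_pure (lmull_bilin e).1 (bilin_pure _ _).1.
Qed.

Fact practB : bilin pract.
Proof.
split=> [a | t]; first exact: pract_linear.
move=> c a b; move: t.
apply: tens_linear_ext => [||l r]; first exact: pract_linear.
  by apply: linear_combine; exact: pract_linear.
by rewrite !pract_pure (rmulr_bilin f).2 (bilin_pure _ _).2.
Qed.

Fact plact1 t : plact 1 t = t.
Proof.
apply: (@tens_linear_ext _ _ _ _ (plact 1) id) t => [||l r].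
- exact: plact_linear.
- exact: linear_id.
by rewrite plact_pure; congr pure; apply: val_inj; rewrite /= mul1r.
Qed.

Fact pract1 t : pract t 1 = t.
Proof.
apply: (@tens_linear_ext _ _ _ _ (pract^~ 1) id) t => [||l r].
- exact: pract_linear.
- exact: linear_id.
by rewrite pract_pure; congr pure; apply: val_inj; rewrite /= mulr1.
Qed.

Fact plactM a b t : plact (a * b) t = plact a (plact b t).
Proof.
move: t; apply: tens_linear_ext => [||l r]; first exact: plact_linear.
  by apply: linear_comp; exact: plact_linear.
by rewrite !plact_pure; congr pure; apply: val_inj; rewrite /= mulrA.
Qed.

Fact practM t a b : pract t (a * b) = pract (pract t a) b.
Proof.
move: t; apply: tens_linear_ext => [||l r]; first exact: pract_linear.
  by apply: linear_comp; exact: pract_linear.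
by rewrite !pract_pure; congr pure; apply: val_inj; rewrite /= mulrA.
Qed.

Fact plractA a t b : pract (plact a t) b = plact a (pract t b).
Proof.
move: t; apply: tens_linear_ext => [||l r].
- by apply: (linear_comp (f := pract^~ b) (g := plact a));
    [exact: pract_linear | exact: plact_linear].
- by apply: (linear_comp (f := plact a) (g := pract^~ b));
    [exact: plact_linear | exact: pract_linear].
by rewrite plact_pure !pract_pure plact_pure.
Qed.

HB.instance Definition _ := @Lmodule_isBimodule.Build K A proj_bimod
  plact pract plactB practB plact1 pract1 plactM practM plractA.

End ProjectiveBimodule.

Section DirectSum.
Variables (K : fieldType) (A : algType K) (J : finType) (M : J -> bimodType A).

Definition dsum : Type := {dffun forall j, M j}.

HB.instance Definition _ := Choice.on dsum.

Implicit Types x y z : dsum.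

Definition dsum_zero : dsum := [ffun j => 0].
Definition dsum_opp x : dsum := [ffun j => - x j].
Definition dsum_add x y : dsum := [ffun j => x j + y j].
Definition dsum_scale (c : K) x : dsum := [ffun j => c *: x j].
Definition dsum_lact (a : A) x : dsum := [ffun j => lact a (x j)].
Definition dsum_ract x (a : A) : dsum := [ffun j => ract (x j) a].

Fact dsum_addA : associative dsum_add.
Proof. by move=> x y z; apply/ffunP => j; rewrite !ffunE addrA. Qed.
Fact dsum_addC : commutative dsum_add.
Proof. by move=> x y; apply/ffunP => j; rewrite !ffunE addrC. Qed.
Fact dsum_add0 : left_id dsum_zero dsum_add.
Proof. by move=> x; apply/ffunP => j; rewrite !ffunE add0r. Qed.
Fact dsum_addN : left_inverse dsum_zero dsum_opp dsum_add.
Proof. by move=> x; apply/ffunP => j; rewrite !ffunE addNr. Qed.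

HB.instance Definition _ :=
  GRing.isZmodule.Build dsum dsum_addA dsum_addC dsum_add0 dsum_addN.

Lemma dsumDE x y j : (x + y) j = x j + y j.
Proof. by rewrite ffunE. Qed.

Fact dsum_scaleA a b x : dsum_scale a (dsum_scale b x) = dsum_scale (a * b) x.
Proof. by apply/ffunP => j; rewrite !ffunE scalerA. Qed.
Fact dsum_scale1 : left_id 1 dsum_scale.
Proof. by move=> x; apply/ffunP => j; rewrite !ffunE scale1r. Qed.
Fact dsum_scaleDr : right_distributive dsum_scale +%R.
Proof. by move=> a x y; apply/ffunP => j; rewrite !ffunE scalerDr. Qed.
Fact dsum_scaleDl x : {morph dsum_scale^~ x : a b / a + b}.
Proof. by move=> a b; apply/ffunP => j; rewrite !ffunE scalerDl. Qed.

HB.instance Definition _ := GRing.Zmodule_isLmodule.Build K dsum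
  dsum_scaleA dsum_scale1 dsum_scaleDr dsum_scaleDl.

Lemma dsumZE c x j : (c *: x) j = c *: x j.
Proof. by rewrite ffunE. Qed.

Fact dsum_lactB : bilin dsum_lact.
Proof.
by split=> [x | a] c y z; apply/ffunP => j;
  rewrite !(dsumDE, dsumZE, ffunE) ?lactB.1 ?lactB.2.
Qed.
Fact dsum_ractB : bilin dsum_ract.
Proof.
by split=> [x | a] c y z; apply/ffunP => j;
  rewrite !(dsumDE, dsumZE, ffunE) ?ractB.1 ?ractB.2.
Qed.
Fact dsum_lact1 x : dsum_lact 1 x = x.
Proof. by apply/ffunP => j; rewrite !ffunE lact1. Qed.
Fact dsum_ract1 x : dsum_ract x 1 = x.
Proof. by apply/ffunP => j; rewrite !ffunE ract1. Qed.
Fact dsum_lactM a b x : dsum_lact (a * b) x = dsum_lact a (dsum_lact b x).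
Proof. by apply/ffunP => j; rewrite !ffunE lactM. Qed.
Fact dsum_ractM x a b : dsum_ract x (a * b) = dsum_ract (dsum_ract x a) b.
Proof. by apply/ffunP => j; rewrite !ffunE ractM. Qed.
Fact dsum_lractA a x b :
  dsum_ract (dsum_lact a x) b = dsum_lact a (dsum_ract x b).
Proof. by apply/ffunP => j; rewrite !ffunE lractA. Qed.

HB.instance Definition _ := @Lmodule_isBimodule.Build K A dsum
  dsum_lact dsum_ract dsum_lactB dsum_ractB dsum_lact1 dsum_ract1
  dsum_lactM dsum_ractM dsum_lractA.

Definition dsum_in (j : J) (m : M j) : dsum :=
  finfun (dfwith (fun i => 0 : M i) m).

End DirectSum.

Section GenLift.
Variables (K : fieldType) (A : algType K) (J : finType) (e f : J -> A).

Definition gen_bimod := dsum (fun j => proj_bimod (e j) (f j) : bimodType A).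

HB.instance Definition _ := Bimodule.on gen_bimod.

(* The generator e_j (x) f_j, when e_j and f_j are idempotent. *)
Definition gen (j : J) : gen_bimod :=
  dsum_in (M := fun j => proj_bimod (e j) (f j) : bimodType A)
    (pure (lproj (e j) 1) (rproj (f j) 1)).

(* The bimodule homomorphism sending e_j (x) f_j to m_j, when
   e_j m_j f_j = m_j for all j. *)
Definition gen_lift (N : bimodType A) (m : J -> N) (z : gen_bimod) : N :=
  \sum_j tlift (fun (l : lideal (e j)) (r : rideal (f j)) =>
                  ract (lact (val l) (m j)) (val r)) (z j).

Section GenLiftTheory.
Variables (N : bimodType A) (m : J -> N).

Fact gen_lift_aux j : bilin (fun (l : lideal (e j)) (r : rideal (f j)) =>
  ract (lact (val l) (m j)) (val r)).
Proof. by split=> [r | l] c x y; rewrite /= ?lactB.1 (ractB.1, ractB.2). Qed.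

Lemma gen_lift_hom : bimod_hom (gen_lift m).
Proof.
split=> [c z w | a z | z a]; rewrite /gen_lift.
- rewrite scaler_sumr -big_split /=; apply: eq_bigr => j _.
  by rewrite dsumDE dsumZE (tlift_is_linear (gen_lift_aux j)).
- have lactS : linear (lact a : N -> N) by exact: lactB.2.
  pose L := GRing.isLinear.Build K N N *:%R (lact a) lactS.
  pose LL : {linear N -> N} := HB.pack (lact a : N -> N) L.
  rewrite -[RHS]/(LL _) linear_sum /=; apply: eq_bigr => j _.
  rewrite ffunE; move: (z j); apply: tens_linear_ext => [||l r].
  + apply: linear_comp; last exact: plact_linear.
    exact: tlift_is_linear (gen_lift_aux j).
  + apply: (linear_comp (f := lact a : N -> N)) => //.
    exact: tlift_is_linear (gen_lift_aux j).
  have -> : lact a (pure l r : proj_bimod (e j) (f j)) = pure (lmull a l) r.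
    exact: plact_pure.
  by rewrite !(tlift_pure (gen_lift_aux j)) /= lactM lractA.
have ractS : linear (fun x : N => ract x a) by exact: ractB.1.
pose L := GRing.isLinear.Build K N N *:%R (fun x : N => ract x a) ractS.
pose LL : {linear N -> N} := HB.pack (fun x : N => ract x a) L.
rewrite -[RHS]/(LL _) linear_sum /=; apply: eq_bigr => j _.
rewrite ffunE; move: (z j); apply: tens_linear_ext => [||l r].
- apply: linear_comp; last exact: pract_linear.
  exact: tlift_is_linear (gen_lift_aux j).
- apply: (linear_comp (f := fun x : N => ract x a)) => //.
  exact: tlift_is_linear (gen_lift_aux j).
have -> : ract (pure l r : proj_bimod (e j) (f j)) a = pure l (rmulr r a).
  exact: pract_pure.
by rewrite !(tlift_pure (gen_lift_aux j)) /= ractM.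
Qed.

Lemma gen_lift_gen j : gen_lift m (gen j) = ract (lact (e j) (m j)) (f j).
Proof.
rewrite /gen_lift (bigD1 j) //= big1 ?addr0 => [|i ij].
  rewrite /gen /dsum_in ffunE dfwith_in (tlift_pure (gen_lift_aux j)) /=.
  by rewrite mul1r mulr1.
have t0 : tlift (fun (l : lideal (e i)) (r : rideal (f i)) =>
    ract (lact (val l) (m i)) (val r)) 0 = 0.
  have := tlift_is_linear (gen_lift_aux i) (-1) 0 0.
  by rewrite scaler0 addr0 scaleN1r addNr.
by rewrite /gen /dsum_in ffunE dfwith_out // eq_sym.
Qed.

End GenLiftTheory.
End GenLift.

(* There is at least one vertex, so that the path algebra is nonzero. *)
Record quiver := Quiver {
  vert : finType;
  arr : finType;
  src : arr -> vert;
  tgt : arr -> vert;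
  vert_gt0 : (0 < #|vert|)%N
}.

Section Paths.
Variable Q : quiver.

Fixpoint composable (v : vert Q) (w : seq (arr Q)) : bool :=
  if w is a :: w' then (src a == v) && composable (tgt a) w' else true.

(* A path is its start vertex together with its arrows, read left to right. *)
Definition qpath : Type :=
  {p : vert Q * seq (arr Q) | composable p.1 p.2}.

HB.instance Definition _ := SubChoice.on qpath.

Implicit Types p q : qpath.

Definition pstart p : vert Q := (val p).1.
Definition parrows p : seq (arr Q) := (val p).2.
Definition pend p : vert Q := last (pstart p) (map (@tgt Q) (parrows p)).
Definition plength p : nat := size (parrows p).

Definition pvert (v : vert Q) : qpath := exist _ (v, [::]) isT.

Fact parr_proof (a : arr Q) : composable (src a) [:: a].
Proof. by rewrite /= eqxx. Qed.
Definition parr (a : arr Q) : qpath := exist _ (src a, [:: a]) (parr_proof a).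

(* Concatenation; only meaningful when [pend p = pstart q]. *)
Definition pcat p q : qpath := insubd p (pstart p, parrows p ++ parrows q).

Lemma composable_cat v w w' : composable v (w ++ w') =
  composable v w && composable (last v (map (@tgt Q) w)) w'.
Proof. by elim: w v => //= a w IH v; rewrite IH andbA. Qed.

Lemma pcat_val p q : pend p = pstart q ->
  val (pcat p q) = (pstart p, parrows p ++ parrows q).
Proof.
move=> pq; rewrite /pcat insubdK // unfold_in /= composable_cat -/(pend p) pq.
by rewrite (valP p) (valP q).
Qed.

Lemma pcat_start p q : pstart (pcat p q) = pstart p.
Proof. by rewrite /pstart /pcat val_insubd; case: ifP. Qed.

Lemma pcat_end p q : pend p = pstart q -> pend (pcat p q) = pend q.
Proof.
move=> pq; rewrite /pend /pstart /parrows pcat_val //= map_cat last_cat.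
by rewrite -/(pend p) pq.
Qed.

Lemma pcatA p q r : pend p = pstart q -> pend q = pstart r ->
  pcat (pcat p q) r = pcat p (pcat q r).
Proof.
move=> pq qr; apply: val_inj.
rewrite !pcat_val ?pcat_end ?pcat_start //.
by rewrite /parrows !pcat_val //= catA.
Qed.

End Paths.

Definition pathalg (K : fieldType) (Q : quiver) : Type := {malg K[qpath Q]}.

HB.instance Definition _ K Q := GRing.Lmodule.on (pathalg K Q).

HB.lock Definition pbasis (K : fieldType) (Q : quiver) (p : qpath Q) :
  pathalg K Q := << p >>.

Section PathAlgebra.
Variables (K : fieldType) (Q : quiver).
Local Notation pathalg := (pathalg K Q).
Local Notation pbasis := (@pbasis K Q).

Lemma pathalg_ext (W : lmodType K) (f g : pathalg -> W) :
  linear f -> linear g -> (forall p, f (pbasis p) = g (pbasis p)) -> f =1 g.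
Proof.
move=> lf lg fg; apply: (@malg_linear_extP K _ W f g) => // p.
by move: (fg p); rewrite pbasis.unlock.
Qed.

Definition pmul1 (p q : qpath Q) : pathalg :=
  if pend p == pstart q then pbasis (pcat p q) else 0.

Definition pmul (x y : pathalg) : pathalg :=
  mlin (fun p => mlin (pmul1 p) y) x.

Definition pone : pathalg := \sum_(v : vert Q) pbasis (pvert v).

Fact pmul_bilin : bilin pmul.
Proof.
split=> [y | x] c u v; first exact: mlin_is_linear.
rewrite /pmul /mlin scaler_sumr -big_split /=; apply: eq_bigr => p _.
rewrite -/(mlin (pmul1 p) _) mlin_is_linear scalerDr !scalerA.
by rewrite [_ * c]mulrC.
Qed.

Lemma pmul_basis p q : pmul (pbasis p) (pbasis q) = pmul1 p q.
Proof. by rewrite pbasis.unlock /pmul !mlinU. Qed.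

Fact pmul0 x : pmul x 0 = 0.
Proof. exact: bilin0r pmul_bilin x. Qed.

Fact p0mul x : pmul 0 x = 0.
Proof. exact: bilin0l pmul_bilin x. Qed.

Lemma pmul1_comp p q : pend p = pstart q -> pmul1 p q = pbasis (pcat p q).
Proof. by rewrite /pmul1 => ->; rewrite eqxx. Qed.

Lemma pmul1_ncomp p q : pend p <> pstart q -> pmul1 p q = 0.
Proof. by move=> /eqP pq; rewrite /pmul1 ifN. Qed.

Lemma pmul1A p q r : pmul (pmul1 p q) (pbasis r) = pmul (pbasis p) (pmul1 q r).
Proof.
have [pq|/eqP pq] := eqVneq (pend p) (pstart q);
  have [qr|/eqP qr] := eqVneq (pend q) (pstart r).
- rewrite (pmul1_comp pq) (pmul1_comp qr) !pmul_basis.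
  by rewrite !pmul1_comp ?pcat_end ?pcat_start // pcatA.
- rewrite (pmul1_comp pq) (pmul1_ncomp qr) (pmul0 (pbasis p)) pmul_basis.
  by rewrite pmul1_ncomp ?pcat_end.
- rewrite (pmul1_ncomp pq) (pmul1_comp qr) (p0mul (pbasis r)) pmul_basis.
  by rewrite pmul1_ncomp ?pcat_start.
- by rewrite (pmul1_ncomp pq) (pmul1_ncomp qr) (p0mul (pbasis r)) (pmul0 (pbasis p)).
Qed.

Fact pmulA : associative pmul.
Proof.
move=> x y z; apply/esym; move: x.
apply: pathalg_ext => [||p].
- apply: (linear_comp (f := pmul^~ z) (g := pmul^~ y)); exact: pmul_bilin.1.
- exact: pmul_bilin.1.
move: y; apply: pathalg_ext => [||q].
- apply: (linear_comp (f := pmul^~ z)); [exact: pmul_bilin.1 | exact: pmul_bilin.2].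
- apply: (linear_comp (g := pmul^~ z)); [exact: pmul_bilin.2 | exact: pmul_bilin.1].
move: z; apply: pathalg_ext => [||r].
- exact: pmul_bilin.2.
- apply: (linear_comp (f := pmul (pbasis p))); exact: pmul_bilin.2.
by rewrite (pmul_basis p q) (pmul_basis q r) pmul1A.
Qed.

Fact pmul1x : left_id pone pmul.
Proof.
apply: pathalg_ext => [||q]; [exact: pmul_bilin.2 | exact: linear_id |].
have plin : linear (pmul^~ (pbasis q)) by exact: pmul_bilin.1.
pose L := GRing.isLinear.Build K pathalg pathalg *:%R (pmul^~ (pbasis q)) plin.
pose LL : {linear pathalg -> pathalg} := HB.pack (pmul^~ (pbasis q)) L.
rewrite -[LHS]/(LL pone) linear_sum /= (bigD1 (pstart q)) //=.
rewrite pmul_basis /pmul1 eqxx big1 ?addr0 => [|v vq].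
  congr pbasis; apply: val_inj; rewrite pcat_val //.
  exact/esym/surjective_pairing.
by rewrite pmul_basis /pmul1 ifN.
Qed.

Fact pmulx1 : right_id pone pmul.
Proof.
apply: pathalg_ext => [||q]; [exact: pmul_bilin.1 | exact: linear_id |].
have plin : linear (pmul (pbasis q)) by exact: pmul_bilin.2.
pose L := GRing.isLinear.Build K pathalg pathalg *:%R (pmul (pbasis q)) plin.
pose LL : {linear pathalg -> pathalg} := HB.pack (pmul (pbasis q)) L.
rewrite -[LHS]/(LL pone) linear_sum /= (bigD1 (pend q)) //=.
rewrite pmul_basis /pmul1 eqxx big1 ?addr0 => [|v vq].
  congr pbasis; apply: val_inj; rewrite pcat_val //= cats0.
  exact/esym/surjective_pairing.
by rewrite pmul_basis /pmul1 ifN // eq_sym.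
Qed.

Fact pmulDl : left_distributive pmul +%R.
Proof. by move=> x y z; apply: bilinDl pmul_bilin _ _ _. Qed.

Fact pmulDr : right_distributive pmul +%R.
Proof. by move=> x y z; apply: bilinDr pmul_bilin _ _ _. Qed.

Fact pone_neq0 : pone != 0.
Proof.
have [v _] := card_gt0P (vert_gt0 Q).
have cE w : (pbasis (pvert w))@_(pvert v) = (w == v)%:R :> K.
  rewrite pbasis.unlock mcoeffU; congr ((nat_of_bool _)%:R).
  by apply/eqP/eqP => [/(congr1 val)[] | ->].
apply/eqP => /(congr1 (mcoeff (pvert v))).
rewrite mcoeff0 raddf_sum (eq_bigr _ (fun w _ => cE w)) (bigD1 v) //= eqxx.
rewrite big1 => [/eqP | w /negPf -> //].
by rewrite addr0 oner_eq0.
Qed.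

HB.instance Definition _ := GRing.Zmodule_isNzRing.Build pathalg
  pmulA pmul1x pmulx1 pmulDl pmulDr pone_neq0.

Fact pscaleAl (c : K) (x y : pathalg) : c *: (x * y) = c *: x * y.
Proof. exact: esym (bilinZl pmul_bilin c x y). Qed.

HB.instance Definition _ := GRing.Lmodule_isLalgebra.Build K pathalg pscaleAl.

Fact pscaleAr (c : K) (x y : pathalg) : c *: (x * y) = x * (c *: y).
Proof. exact: esym (bilinZr pmul_bilin c x y). Qed.

HB.instance Definition _ := GRing.Lalgebra_isAlgebra.Build K pathalg pscaleAr.

Lemma pbasisM p q :
  pbasis p * pbasis q = if pend p == pstart q then pbasis (pcat p q) else 0.
Proof. exact: pmul_basis. Qed.

Definition two_sided_ideal (S : set pathalg) : Prop :=
  [/\ S 0, forall x y, S x -> S y -> S (x - y),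
      forall a x, S x -> S (a * x) & forall a x, S x -> S (x * a)].

Definition ideal_gen (X : set pathalg) : set pathalg :=
  smallest two_sided_ideal X.

(* The n-th power of the ideal generated by the arrows: the span of the paths
   of length at least n. *)
Definition arrow_ideal_pow (n : nat) : set pathalg :=
  [set x | forall p, p \in msupp x -> (n <= plength p)%N].

Definition admissible (I : alg_ideal pathalg) : Prop :=
  [set` I] `<=` arrow_ideal_pow 2 /\
  exists2 N, (2 <= N)%N & arrow_ideal_pow N `<=` [set` I].

(* A uniform element, together with its start and end vertices. *)
Definition uniform_elt : Type :=
  {x : pathalg * (vert Q * vert Q) |
    [forall p : msupp x.1, (pstart (val p) == x.2.1) && (pend (val p) == x.2.2)]}.

HB.instance Definition _ := SubChoice.on uniform_elt.

Definition uval (x : uniform_elt) : pathalg := (val x).1.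
Definition usrc (x : uniform_elt) : vert Q := (val x).2.1.
Definition utgt (x : uniform_elt) : vert Q := (val x).2.2.

Definition minimal_generating_set (I : alg_ideal pathalg)
    (f2 : {fset uniform_elt}) : Prop :=
  ideal_gen (uval @` [set` f2]) = [set` I] /\
  forall g : {fset uniform_elt}, (g `<` f2)%fset ->
    ideal_gen (uval @` [set` g]) <> [set` I].

Section Tips.
Variables (leV : rel (vert Q)) (leA : rel (arr Q)).

(* Only used on sequences of the same length. *)
Fixpoint lexle (s t : seq (arr Q)) : bool :=
  match s, t with
  | [::], _ => true
  | _ :: _, [::] => false
  | a :: s', b :: t' => if a == b then lexle s' t' else leA a b
  end.

Definition path_le (p q : qpath Q) : bool :=
  (plength p < plength q)%N ||
  (plength p == plength q) &&
    (if plength p == 0%N then leV (pstart p) (pstart q)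
     else lexle (parrows p) (parrows q)).

Definition is_tip (x : pathalg) (p : qpath Q) : Prop :=
  p \in msupp x /\ forall q, q \in msupp x -> path_le q p.

Definition Tip (I : alg_ideal pathalg) : set (qpath Q) :=
  [set p | exists x, [/\ x \in I, x != 0 & is_tip x p]].

Definition NonTip (I : alg_ideal pathalg) : set (qpath Q) := ~` Tip I.

Definition vNonTip (I : alg_ideal pathalg) (v w : vert Q) : set (qpath Q) :=
  [set p | [/\ NonTip I p, pstart p = v & pend p = w]].

Definition Bdy (f2 : {fset uniform_elt}) : set (vert Q * vert Q) :=
  [set (usrc x, utgt x) | x in [set` f2]].

Definition G2 (I : alg_ideal pathalg) (f2 : {fset uniform_elt}) :
    set (qpath Q) :=
  \bigcup_(vw in Bdy f2) vNonTip I vw.1 vw.2.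

End Tips.

(* v f^2 w *)
Definition f2_between (f2 : {fset uniform_elt}) (v w : vert Q) : set pathalg :=
  [set uval x | x in [set x | [/\ x \in f2, usrc x = v & utgt x = w]]].

End PathAlgebra.

Definition linear_order (T : eqType) (le : rel T) : Prop :=
  [/\ reflexive le, antisymmetric le, transitive le & total le].

Definition finite_dimensional (K : fieldType) (V : lmodType K) : Prop :=
  exists s : seq V, forall v, exists c : 'I_(size s) -> K,
    v = \sum_i c i *: tnth (in_tuple s) i.

Definition associated_arrow (Q : quiver) (X : set (qpath Q)) (p : qpath Q)
    (a : arr Q) : Prop :=
  a \in parrows p /\ forall q, X q -> q <> p -> a \notin parrows q.

Definition L0 (Q : quiver) (X : set (qpath Q)) : set (qpath Q) :=
  [set p | X p /\ exists a, associated_arrow X p a].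

(* Y = {p_1, ..., p_r} U {q_ij} *)
Definition all_paths (Q : quiver) (r : nat) (p : 'I_r -> qpath Q)
    (t : 'I_r -> nat) (q : forall i : 'I_r, 'I_(t i) -> qpath Q) :
    set (qpath Q) :=
  range p `|` [set q' | exists i j, q' = q i j].

Section Resolution.
Variables (K : fieldType) (Q : quiver) (I : alg_ideal (pathalg K Q)).
Variable f2 : {fset uniform_elt K Q}.
Local Notation Lam := (quot_alg I).

Definition ppi (p : qpath Q) : Lam := qpi I (pbasis K p).

Definition videm (v : vert Q) : Lam := ppi (pvert v).

Definition vLamw (v w : vert Q) : set Lam :=
  [set videm v * l * videm w | l in [set: Lam]].

(* The image in Lam of a_1 ... a_n; equal to 1 when n = 0. *)
Definition arrows_prod (s : seq (arr Q)) : Lam := \prod_(a <- s) ppi (parr a).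

Definition Q1 := gen_bimod (fun a : arr Q => videm (src a))
                           (fun a : arr Q => videm (tgt a)).

Definition Q2 := gen_bimod (fun x : f2 => videm (usrc (val x)))
                           (fun x : f2 => videm (utgt (val x))).

(* l (x) r in the summand of Q1 indexed by a, for l in Lam o(a), r in t(a) Lam *)
Definition Q1_elt (a : arr Q) (l r : Lam) : Q1 :=
  dsum_in (M := fun a => proj_bimod (videm (src a)) (videm (tgt a)) : bimodType Lam)
    (pure (lproj (videm (src a)) l) (rproj (videm (tgt a)) r)).

(* The empty products for k = 0 and k = size s - 1 become o(a_k) and t(a_k) in
   [Q1_elt]. *)
Definition A2_path (s : seq (arr Q)) : Q1 :=
  \sum_(k < size s)
     Q1_elt (tnth (in_tuple s) k) (arrows_prod (take k s))
                                  (arrows_prod (drop k.+1 s)).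

Definition A2 : Q2 -> Q1 :=
  gen_lift (fun x : f2 =>
    \sum_(p <- msupp (uval (val x))) (uval (val x))@_p *: A2_path (parrows p)
    : Q1).

Definition Hom1 : set (Q1 -> reg_bimod Lam) :=
  @bimod_hom K Lam Q1 (reg_bimod Lam).
Definition Hom2 : set (Q2 -> reg_bimod Lam) :=
  @bimod_hom K Lam Q2 (reg_bimod Lam).

Definition d2 (f : Q1 -> reg_bimod Lam) : Q2 -> reg_bimod Lam := f \o A2.

Definition Im_d2 : set (Q2 -> reg_bimod Lam) := d2 @` Hom1.

Definition phi (p : qpath Q) (x : f2) : Q2 -> reg_bimod Lam :=
  gen_lift (fun y : f2 => (if y == x then ppi p else 0) : reg_bimod Lam).

Lemma ppiM p q :
  ppi p * ppi q = if pend p == pstart q then ppi (pcat p q) else 0.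
Proof.
by rewrite /ppi -rmorphM /= pbasisM; case: ifP => _ //; rewrite raddf0.
Qed.

Lemma videm_l v p : pstart p = v -> videm v * ppi p = ppi p.
Proof.
move=> pv; rewrite /videm ppiM pv eqxx; congr ppi; apply: val_inj.
by rewrite pcat_val //= -pv; exact/esym/surjective_pairing.
Qed.

Lemma videm_r v p : pend p = v -> ppi p * videm v = ppi p.
Proof.
move=> pv; rewrite /videm ppiM pv eqxx; congr ppi; apply: val_inj.
by rewrite pcat_val //= cats0; exact/esym/surjective_pairing.
Qed.

Lemma A2_hom : @bimod_hom K Lam Q2 Q1 A2.
Proof. exact: gen_lift_hom. Qed.

Lemma phi_hom p x : Hom2 (phi p x).
Proof. exact: gen_lift_hom. Qed.

Lemma phi_gen p (x y : f2) :
  usrc (val x) = pstart p -> utgt (val x) = pend p ->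
  phi p x (gen _ _ y) = if y == x then ppi p else 0.
Proof.
move=> sx tx; rewrite /phi gen_lift_gen; case: eqP => [-> | _].
  rewrite sx tx -[RHS](videm_r (erefl (pend p))).
  by rewrite -{2}(videm_l (erefl (pstart p))).
rewrite (bilin0r (@lactB K Lam (reg_bimod Lam))).
exact: (bilin0l (@ractB K Lam (reg_bimod Lam))).
Qed.

Lemma arrows_prod_l v s : composable v s -> s != [::] ->
  videm v * arrows_prod s = arrows_prod s.
Proof.
case: s => //= a s /andP[/eqP av _] _; rewrite /arrows_prod big_cons mulrA.
by rewrite videm_l.
Qed.

Lemma arrows_prod_r v s : composable v s -> s != [::] ->
  arrows_prod s * videm (last v (map (@tgt Q) s)) = arrows_prod s.
Proof.
elim: s v => //= a s IH v /andP[_ cs] _; rewrite /arrows_prod big_cons -mulrA.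
have [->|s0] := eqVneq s [::].
  by rewrite big_nil mul1r mulr1 /= videm_r.
by rewrite -/(arrows_prod s) IH.
Qed.

Lemma lact_Q1_elt c b l r : lact c (Q1_elt b l r) = Q1_elt b (c * l) r.
Proof.
apply/ffunP => d; rewrite !ffunE; have [<-|bd] := eqVneq b d.
  rewrite !dfwith_in; apply: etrans (plact_pure _ _ _) _.
  by congr pure; apply: val_inj; rewrite /= mulrA.
by rewrite !dfwith_out // (bilin0r lactB).
Qed.

Lemma ract_Q1_elt c b l r : ract (Q1_elt b l r) c = Q1_elt b l (r * c).
Proof.
apply/ffunP => d; rewrite !ffunE; have [<-|bd] := eqVneq b d.
  rewrite !dfwith_in; apply: etrans (pract_pure _ _ _) _.
  by congr pure; apply: val_inj; rewrite /= mulrA.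
by rewrite !dfwith_out // (bilin0l ractB).
Qed.

Lemma A2_path_lr v s : composable v s ->
  ract (lact (videm v) (A2_path s)) (videm (last v (map (@tgt Q) s))) = A2_path s.
Proof.
move=> cs; pose L (z : Q1) : Q1 :=
  ract (lact (videm v) z) (videm (last v (map (@tgt Q) s))).
have Llin : linear L by move=> c y z; rewrite /L lactB.2 ractB.1.
pose LM := GRing.isLinear.Build K Q1 Q1 *:%R L Llin.
pose LL : {linear Q1 -> Q1} := HB.pack L LM.
rewrite -/(L _) -[LHS]/(LL _) linear_sum /=; apply: eq_bigr => k _.
rewrite /L lact_Q1_elt ract_Q1_elt; set b := tnth _ k.
have sE : s = take k s ++ b :: drop k.+1 s.
  by rewrite {1}/b (tnth_nth b) /= -drop_nth ?cat_take_drop.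
move: cs; rewrite {1}sE composable_cat /= => /and3P[c1 /eqP bv c2].
have lE : last v (map (@tgt Q) s) = last (tgt b) (map (@tgt Q) (drop k.+1 s)).
  by rewrite {1}sE map_cat last_cat.
rewrite lE /Q1_elt; congr dsum_in; congr pure; apply: val_inj => /=.
  have [k0|k0] := eqVneq (take k s) [::].
    move: bv; rewrite k0 /= => ->.
    by rewrite /arrows_prod big_nil mulr1 mul1r videm_l.
  by rewrite arrows_prod_l.
have [k0|k0] := eqVneq (drop k.+1 s) [::].
  by rewrite k0 /= /arrows_prod big_nil mul1r mulr1 videm_l.
by rewrite arrows_prod_r.
Qed.

Lemma A2_gen (x : f2) : A2 (gen _ _ x) =
  \sum_(p <- msupp (uval (val x))) (uval (val x))@_p *: A2_path (parrows p).
Proof.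
rewrite /A2 gen_lift_gen.
pose L (z : Q1) : Q1 :=
  ract (lact (videm (usrc (val x))) z) (videm (utgt (val x))).
have Llin : linear L by move=> c y z; rewrite /L lactB.2 ractB.1.
pose LM := GRing.isLinear.Build K Q1 Q1 *:%R L Llin.
pose LL : {linear Q1 -> Q1} := HB.pack L LM.
rewrite -/(L _) -[LHS]/(LL _) linear_sum /= !big_seq; apply: eq_bigr => p px.
rewrite /L (bilinZr lactB) (bilinZl ractB); congr (_ *: _).
have /forallP/(_ [` px]%fset)/= /andP[/eqP ps /eqP pe] := valP (val x).
by rewrite /usrc /utgt -ps -pe A2_path_lr // (valP p).
Qed.

End Resolution.

Arguments vLamw {K Q} I v w.
Arguments Hom1 {K Q} I.
Arguments Hom2 {K Q} I f2.
Arguments Im_d2 {K Q} I f2.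
Arguments phi {K Q} I {f2} p x.

(* Main.v *)
(* A homomorphism from Q2 is a scalar multiple of p_i on the generator of
   p_i - q_ij, since every path parallel to p_i is, modulo I, a multiple of p_i
   (a path which is not p_i is a tip, and the order is well-founded).  The
   homomorphism on Q1 sending the generator of each arrow b to w(b) b is mapped
   by d2 to the homomorphism with value (w(p_i) - w(q_ij)) p_i there, where w is
   extended additively to paths.  The arrow a_ij occurs once in q_ij and in no
   other element of Y, so its weight can be used to prescribe the value at
   p_i - q_ij without affecting any other value.

   For HH^2, a cocycle, normalised with respect to the vertices, defines a
   square-zero extension of Lam.  Lifting the arrows to it sends the relations
   f2 into the kernel Lam, which gives an element of Hom(Q2, Lam); writing it as
   d2 h and correcting the lifts of the arrows by h, the relations are killed,
   hence so is I, and the extension splits. *)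

Require Import Defs.
From mathcomp Require Import all_boot all_algebra.
From mathcomp Require Import finmap monalg.
From mathcomp Require Import boolp classical_sets.
Import GRing.Theory.

Local Open Scope ring_scope.
Local Open Scope classical_set_scope.

Set Implicit Arguments.
Unset Strict Implicit.

(** * Finite sums under bilinear maps *)

Lemma bilin_suml {K : fieldType} {U V W : lmodType K} (f : U -> V -> W)
    (J : Type) (s : seq J) (P : pred J) (x : J -> U) v :
  bilin f -> f (\sum_(j <- s | P j) x j) v = \sum_(j <- s | P j) f (x j) v.
Proof.
move=> fB; apply: (big_morph (f^~ v)); last exact: bilin0l.
by move=> a b; rewrite (bilinDl fB).
Qed.

Lemma bilin_sumr {K : fieldType} {U V W : lmodType K} (f : U -> V -> W)
    (J : Type) (s : seq J) (P : pred J) u (x : J -> V) :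
  bilin f -> f u (\sum_(j <- s | P j) x j) = \sum_(j <- s | P j) f u (x j).
Proof.
move=> fB; apply: (big_morph (f u)); last exact: bilin0r.
by move=> a b; rewrite (bilinDr fB).
Qed.

(** * Hochschild 2-cocycles and their normalisation at orthogonal idempotents *)

Section HochschildCochains.
Variables (K : fieldType) (A : algType K).
Implicit Types (f : A -> A -> A) (g : A -> A).

Lemma cocycleP f a b c : HH2_cocycle f ->
  f (a * b) c = a * f b c + f a (b * c) - f a b * c.
Proof.
move=> [_ /(_ a b c)/eqP]; rewrite /hoch_d2.
by rewrite subr_eq0 addrAC subr_eq => /eqP ->; rewrite addrAC subrr add0r.
Qed.

Lemma cocycle_mulA f a b c x y z : HH2_cocycle f ->
  a * (b * z + y * c - f b c) + x * (b * c) - f a (b * c) =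
  a * b * z + (a * y + x * b - f a b) * c - f (a * b) c.
Proof.
move=> fC; rewrite (cocycleP _ _ _ fC).
rewrite !(mulrDl, mulrDr, mulrN, mulNr) !opprD !opprK !mulrA !addrA.
rewrite [LHS](ACl (1*2*4*3*5)) [RHS](ACl (1*2*3*5*6*4*7)) /=.
by rewrite subrK.
Qed.

Lemma mulr_lstep (e a b c d x : A) :
  e * (a * b + c * d - x) = e * a * b + e * c * d - e * x.
Proof. by rewrite mulrBr mulrDr !mulrA. Qed.

Lemma mulr_rstep (e a b c d x : A) :
  (a * b + c * d - x) * e = a * (b * e) + c * (d * e) - x * e.
Proof. by rewrite mulrBl mulrDl !mulrA. Qed.

Lemma add_subK (x y z : A) : x - (x + y - z) + y = z.
Proof. by rewrite opprB addrAC addrC subrK. Qed.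

Lemma cocycle_step_sub (a x y m p z : A) :
  a * (x - y) + - m * p - z = a * x + 0 * p - z - (m * p + a * y).
Proof. by rewrite mul0r addr0 mulrBr mulNr opprD !addrA [LHS](ACl (1*4*3*2)). Qed.

Lemma hoch_d1D g h a b :
  hoch_d1 (fun x => g x + h x) a b = hoch_d1 g a b + hoch_d1 h a b.
Proof.
rewrite /hoch_d1 mulrDr mulrDl opprD !addrA.
by rewrite [LHS](ACl (1*3*5*2*4*6)).
Qed.

Lemma mulr_scale_sandwich (e a e' : A) (c : K) :
  e * a = a -> a * e' = a -> e * (c *: a) * e' = c *: a.
Proof. by move=> ea ae'; rewrite -scalerAr -scalerAl ea ae'. Qed.

Lemma mulr_orthogonal (e e' a b : A) :
  e * e' = 0 -> a * e = a -> e' * b = b -> a * b = 0.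
Proof. by move=> e0 <- <-; rewrite mulrA -(mulrA a) e0 mulr0 mul0r. Qed.

Lemma twisted_bilin (V : lmodType K) f (p h : V -> A) :
  bilin f -> linear p -> linear h ->
  bilin (fun x y => p x * h y + h x * p y - f (p x) (p y)).
Proof.
move=> fB pL hL; have mB := mul_bilin A.
split=> [y|x] c u v.
  rewrite pL hL !mB.1 fB.1 scalerBr scalerDr opprD !addrA.
  by rewrite [LHS](ACl (1*3*5*2*4*6)).
rewrite pL hL !mB.2 fB.2 scalerBr scalerDr opprD !addrA.
by rewrite [LHS](ACl (1*3*5*2*4*6)).
Qed.

Lemma hoch_d2d1 g a b c : hoch_d2 (hoch_d1 g) a b c = 0.
Proof.
rewrite /hoch_d2 /hoch_d1 !(mulrDl, mulrDr, mulrBl, mulrBr, mulNr, mulrN).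
rewrite !opprD !opprK !mulrA !addrA.
rewrite [LHS](ACl (1*4*5*8*7*2*3*10*9*12*11*6)) /=.
by rewrite !(subrr, add0r).
Qed.

Lemma hoch_d1_bilin g : linear g -> bilin (hoch_d1 g).
Proof.
move=> gL; have mB := mul_bilin A.
split=> [b|a] c x y; rewrite /hoch_d1.
  rewrite mB.1 mB.1 !gL mB.1 !scalerDr scalerN opprD.
  by rewrite !addrA [LHS](ACl (1*3*5*2*4*6)) /=.
rewrite mB.2 mB.2 !gL mB.2 !scalerDr scalerN opprD.
by rewrite !addrA [LHS](ACl (1*3*5*2*4*6)) /=.
Qed.

Lemma cocycleB f g : linear g -> HH2_cocycle f ->
  HH2_cocycle (fun a b => f a b - hoch_d1 g a b).
Proof.
move=> gL [fB f0]; have dB := hoch_d1_bilin gL; split.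
  split=> [b|a] c x y; rewrite ?fB.1 ?fB.2 ?dB.1 ?dB.2 opprD scalerBr;
  by rewrite !addrA [LHS](ACl (1*3*2*4)) /=.
move=> a b c; rewrite -(f0 a b c) -[RHS]subr0 -(hoch_d2d1 g a b c).
rewrite /hoch_d2; move: (hoch_d1 g) {dB} => h.
rewrite mulrBr mulrBl !opprD !opprK !addrA.
by rewrite [LHS](ACl (1*3*5*7*2*4*6*8)).
Qed.

Section Normalisation.
Variables (J : finType) (e : J -> A).
Hypothesis eM : forall i j, e i * e j = if i == j then e i else 0.
Hypothesis e_sum : \sum_j e j = 1.

(** The correction averages f over the separability element sum_i e_i (x) e_i of the span of the
    idempotents: the usual contracting homotopy. *)
Lemma normalise_l f : HH2_cocycle f -> exists2 g, linear g &
  forall j b, f (e j) b = hoch_d1 g (e j) b.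
Proof.
move=> fC; have fB := fC.1.
exists (fun b => \sum_i e i * f (e i) b).
  move=> c x y; rewrite scaler_sumr -big_split /=; apply: eq_bigr => i _.
  by rewrite fB.2 mulrDr scalerAr.
move=> j b; rewrite /hoch_d1.
(* Only i = j survives on either side; in this form the cocycle identity at e_i, e_j, b applies term
   by term. *)
have -> : e j * (\sum_i e i * f (e i) b) = \sum_i e i * f (e i * e j) b.
  rewrite mulr_sumr; apply: eq_bigr => i _; rewrite mulrA !eM eq_sym.
  by have [->|_] := eqVneq i j; rewrite // mul0r (bilin0l fB) mulr0.
rewrite mulr_suml -sumrB -big_split /= -[LHS]mul1r -e_sum mulr_suml.
apply: eq_bigr => i _; rewrite (cocycleP _ _ _ fC) mulrBr mulrDr !mulrA.
by rewrite (eM i i) eqxx addrAC subrK addrK.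
Qed.

(** The mirror-image correction. As f already vanishes at each e_j on the left, it commutes with
    left multiplication by e_j in its first argument, and so does g; hence subtracting the
    coboundary of g preserves the normalisation on the left. *)
Lemma normalise_r f : HH2_cocycle f -> (forall j b, f (e j) b = 0) ->
  exists2 g, linear g &
    (forall j b, hoch_d1 g (e j) b = 0) /\
    (forall a j, f a (e j) = hoch_d1 g a (e j)).
Proof.
move=> fC fe0; have fB := fC.1.
have fe j b c : f (e j * b) c = e j * f b c.
  by rewrite (cocycleP _ _ _ fC) !fe0 mul0r subr0 addr0.
pose g a := \sum_i f a (e i) * e i.
have ge j b : g (e j * b) = e j * g b.
  by rewrite /g mulr_sumr; apply: eq_bigr => i _; rewrite fe mulrA.
have ge0 j : g (e j) = 0.
  by rewrite /g big1 // => i _; rewrite fe0 mul0r.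
exists g; first move=> c x y.
  rewrite scaler_sumr -big_split /=; apply: eq_bigr => i _.
  by rewrite fB.1 mulrDl scalerAl.
split=> [j b|a j]; first by rewrite /hoch_d1 ge ge0 mul0r subrr addr0.
rewrite /hoch_d1 ge0 mulr0 sub0r.
have -> : g a * e j = \sum_i f a (e j * e i) * e i.
  rewrite /g mulr_suml; apply: eq_bigr => i _; rewrite -mulrA !eM eq_sym.
  by have [->|_] := eqVneq i j; rewrite ?eqxx // (bilin0r fB) mulr0 mul0r.
rewrite addrC -sumrB -[LHS]mulr1 -e_sum mulr_sumr.
apply: eq_bigr => i _; rewrite (cocycleP _ _ _ fC) fe0 mulr0 add0r mulrBl.
rewrite -[in X in _ - (_ - X)]mulrA (eM i i) eqxx.
by rewrite opprB addrC subrK.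
Qed.

Lemma normalise f : HH2_cocycle f -> exists2 g, linear g &
  exists F, [/\ HH2_cocycle F, forall j b, F (e j) b = 0,
    forall a j, F a (e j) = 0 & forall a b, f a b = hoch_d1 g a b + F a b].
Proof.
move=> fC; have [g gL fg] := normalise_l fC.
have f1C := cocycleB gL fC.
have f10 j b : f (e j) b - hoch_d1 g (e j) b = 0 by rewrite fg subrr.
have [h hL [h0 fh]] := normalise_r f1C f10.
exists (fun x => g x + h x).
  move=> c x y; rewrite gL hL scalerDr addrACA //.
exists (fun a b => f a b - hoch_d1 g a b - hoch_d1 h a b); split.
- exact: cocycleB.
- by move=> j b; rewrite f10 h0 subrr.
- by move=> a j; rewrite fh subrr.
move=> a b; rewrite hoch_d1D.
by rewrite -[f a b - _ - _]addrA -opprD [RHS]addrC subrK.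
Qed.

End Normalisation.
End HochschildCochains.

(** * Linear maps given as bare functions *)

Lemma linear0E {K : fieldType} {U V : lmodType K} (h : U -> V) :
  linear h -> h 0 = 0.
Proof.
by move=> hL; have := hL (-1) 0 0; rewrite scaler0 addr0 scaleN1r addNr.
Qed.

Lemma linearBE {K : fieldType} {U V : lmodType K} (h : U -> V) x y :
  linear h -> h (x - y) = h x - h y.
Proof. by move=> hL; rewrite addrC -scaleN1r hL scaleN1r addrC. Qed.

Lemma linear_sumE {K : fieldType} {U V : lmodType K} (h : U -> V)
    (J : Type) (s : seq J) (P : pred J) (x : J -> U) :
  linear h -> h (\sum_(j <- s | P j) x j) = \sum_(j <- s | P j) h (x j).
Proof.
move=> hL; apply: (big_morph h); last exact: linear0E.
by move=> a b; have := hL 1 a b; rewrite !scale1r.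
Qed.

Lemma linear_scaleE {K : fieldType} {U V : lmodType K} (h : U -> V) c x :
  linear h -> h (c *: x) = c *: h x.
Proof.
by move=> hL; have := hL c x 0; rewrite (linear0E hL) !addr0.
Qed.

(** * Bimodules generated by elements e_j (x) f_j *)

Section GeneratedBimodule.
Variables (K : fieldType) (A : algType K) (J : finType).

Lemma dsum_in_linear (M : J -> bimodType A) j :
  linear (fun m : M j => dsum_in m : dsum M).
Proof.
move=> c x y; apply/ffunP => i; rewrite !ffunE.
have [<-|ij] := eqVneq j i; first by rewrite !dfwith_in.
by rewrite !dfwith_out // scaler0 addr0.
Qed.

Lemma dsum_in_sum (M : J -> bimodType A) (z : dsum M) :
  z = \sum_j dsum_in (z j).
Proof.
apply/ffunP => i.
have evL : linear (fun z : dsum M => z i) by move=> c x y; rewrite !ffunE.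
rewrite (linear_sumE _ _ _ evL) (bigD1 i) //= ffunE dfwith_in.
by rewrite big1 ?addr0 // => j ji; rewrite ffunE dfwith_out.
Qed.

Variables (e f : J -> A) (N : bimodType A).

(** A pure tensor in the j-th summand is a e_j (x) f_j b, that is, the generator multiplied by a on
    the left and b on the right; such elements span. *)
Lemma gen_hom_ext (h k : gen_bimod e f -> N) :
  bimod_hom h -> bimod_hom k -> (forall j, h (gen e f j) = k (gen e f j)) ->
  h = k.
Proof.
move=> [hL hl hr] [kL kl kr] hk; apply/funext => z; rewrite [z]dsum_in_sum.
rewrite (linear_sumE _ _ _ hL) (linear_sumE _ _ _ kL).
apply: eq_bigr => j _; move: (z j).
apply: tens_linear_ext => [||[l lP] [r rP]].
- exact: linear_comp hL (@dsum_in_linear _ j).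
- exact: linear_comp kL (@dsum_in_linear _ j).
have [a la] : exists a, l = a * e j by apply/asboolP.
have [b rb] : exists b, r = f j * b by apply/asboolP.
have -> : dsum_in (M := fun j => proj_bimod (e j) (f j) : bimodType A)
      (pure (exist _ l lP : lideal (e j)) (exist _ r rP : rideal (f j)))
    = ract (lact a (gen e f j)) b :> gen_bimod e f.
  apply/ffunP => i; rewrite !ffunE; have [<-|ij] := eqVneq j i.
    rewrite !dfwith_in.
    have -> : lact a (pure (lproj (e j) 1) (rproj (f j) 1) : proj_bimod (e j) (f j))
       = pure (lmull a (lproj (e j) 1)) (rproj (f j) 1) by exact: plact_pure.
    apply/esym; apply: etrans (pract_pure _ _ _) _.
    by congr pure; apply: val_inj; rewrite /= ?mul1r ?mulr1.
  by rewrite !dfwith_out // (bilin0r lactB) (bilin0l ractB).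
by rewrite hr kr hl kl hk.
Qed.

End GeneratedBimodule.

(** * Homomorphisms out of [Q1] and their values on A_2 of a word *)

Section HomFromQ1.
Variables (K : fieldType) (Q : quiver) (I : alg_ideal (pathalg K Q)).
Local Notation Lam := (quot_alg I).
Local Notation P := (@arrows_prod K Q I).
Local Notation gen1 a :=
  (gen (fun a : arr Q => videm I (src a)) (fun a : arr Q => videm I (tgt a)) a).

Lemma qpi_linear : linear (qpi I).
Proof. exact: spi_is_linear. Qed.

Lemma qpi_ideal x : x \in I -> qpi I x = 0.
Proof. by move=> xI; apply/eqP; rewrite -(raddf0 (qpi I)) qpi_eqE subr0. Qed.

Lemma videmM v w : videm I v * videm I w = if v == w then videm I v else 0.
Proof.
rewrite /videm ppiM /=; case: eqP => //= vw; congr ppi; apply: val_inj.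
by rewrite pcat_val.
Qed.

Lemma videm_sum : \sum_v videm I v = 1.
Proof. by rewrite -(rmorph1 (qpi I)) /= raddf_sum. Qed.

Lemma ppi_arrows_prod u : parrows u != [::] -> ppi I u = P (parrows u).
Proof.
case: u => -[v s] /=; rewrite /parrows /=.
elim: s v => //= a s IHs v c _; case/andP: (c) => /eqP av cs.
rewrite /arrows_prod big_cons -/(P s).
have [s0|s0] := eqVneq s [::].
  have -> : P s = 1 by rewrite s0 /arrows_prod big_nil.
  by rewrite mulr1; congr ppi; apply: val_inj; rewrite /= av s0.
rewrite -(IHs (tgt a) cs s0) ppiM eqxx; congr ppi; apply: val_inj.
by rewrite pcat_val //= -av.
Qed.

Variable h : Q1 I -> reg_bimod Lam.
Hypothesis hH : Hom1 I h.

Lemma Hom1_Q1_elt_r a r : h (Q1_elt a 1 r) = h (gen1 a) * r :> Lam.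
Proof.
case: (hH) => _ _ hr; rewrite -[r in LHS]mul1r -ract_Q1_elt; exact: hr.
Qed.

Lemma Hom1_Q1_elt a l r : h (Q1_elt a l r) = l * h (gen1 a) * r :> Lam.
Proof.
rewrite -[l in LHS]mulr1 -lact_Q1_elt -mulrA -Hom1_Q1_elt_r.
by case: (hH) => _ hl _; apply: hl.
Qed.

(** The generator indexed by [a] is o(a) (x) t(a), fixed by o(a) on the left and by t(a) on the
    right; a homomorphism carries this over to its value. *)
Lemma Hom1_gen_l a : videm I (src a) * h (gen1 a) = h (gen1 a) :> Lam.
Proof.
have E : Q1_elt a (videm I (src a)) 1 = gen1 a.
  congr dsum_in; congr pure; apply: val_inj => /=.
  by rewrite mul1r videmM eqxx.
exact: etrans (esym (etrans (Hom1_Q1_elt _ _ _) (mulr1 _))) (congr1 h E).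
Qed.

Lemma Hom1_gen_r a : h (gen1 a) * videm I (tgt a) = h (gen1 a) :> Lam.
Proof.
have E : Q1_elt a 1 (videm I (tgt a)) = gen1 a.
  congr dsum_in; congr pure; apply: val_inj => /=.
  by rewrite mulr1 videmM eqxx.
exact: etrans (esym (Hom1_Q1_elt_r _ _)) (congr1 h E).
Qed.

(** A Leibniz rule along words: the term k = 0 removes [a] itself, and every later term absorbs [a]
    into its left factor. *)
Lemma A2_path_cons a s : A2_path I (a :: s) =
  Q1_elt a 1 (P s) + lact (ppi I (parr a)) (A2_path I s).
Proof.
rewrite /A2_path /= big_ord_recl; congr (_ + _).
  rewrite /= drop0 (tnth_nth a) /=.
  by rewrite /arrows_prod big_nil.
rewrite (bilin_sumr _ _ _ _ lactB); apply: eq_bigr => k _.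
rewrite lact_Q1_elt /= !(tnth_nth a) /=.
by rewrite {1}/arrows_prod big_cons.
Qed.

Lemma Hom1_A2_cons a s : h (A2_path I (a :: s)) =
  h (gen1 a) * P s + ppi I (parr a) * h (A2_path I s) :> Lam.
Proof.
case: (hH) => hL hl _.
have := hL 1 (Q1_elt a 1 (P s)) (lact (ppi I (parr a)) (A2_path I s)).
rewrite A2_path_cons !scale1r => ->; congr (_ + _); last exact: hl.
exact: Hom1_Q1_elt_r.
Qed.

Lemma Hom1_A2_nil : h (A2_path I [::]) = 0 :> Lam.
Proof.
by case: (hH) => hL _ _; rewrite /A2_path big_ord0; apply: linear0E hL.
Qed.

End HomFromQ1.

(** * Lifting paths to the square-zero extension of a normalised cocycle *)

Section LiftOfCocycle.
Variables (K : fieldType) (Q : quiver) (I : alg_ideal (pathalg K Q)).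
Local Notation Lam := (quot_alg I).
Local Notation P := (@arrows_prod K Q I).
Local Notation e v := (videm I v).

Variable F : Lam -> Lam -> Lam.
Hypothesis FC : HH2_cocycle F.
Hypothesis Fl0 : forall v b, F (e v) b = 0.
Hypothesis Fr0 : forall a v, F a (e v) = 0.

Lemma normal_1l b : F 1 b = 0.
Proof. by rewrite -(videm_sum I) (bilin_suml _ _ _ _ FC.1) big1. Qed.

Lemma normal_1r a : F a 1 = 0.
Proof. by rewrite -(videm_sum I) (bilin_sumr _ _ _ _ FC.1) big1. Qed.

(** With a vertex as first, last or middle argument, the cocycle identity loses its terms with a
    vertex inside F. This makes F linear over the vertices on the left and on the right, and
    balanced in the middle. *)
Lemma normal_l v a b : e v * F a b = F (e v * a) b.
Proof. by rewrite (cocycleP _ _ _ FC) !Fl0 mul0r subr0 addr0. Qed.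

Lemma normal_r v a b : F a b * e v = F a (b * e v).
Proof.
apply/eqP; rewrite -subr_eq0 -opprB oppr_eq0.
by have := cocycleP a b (e v) FC; rewrite !Fr0 mulr0 add0r => <-.
Qed.

Lemma normal_m v a b : F (a * e v) b = F a (e v * b).
Proof. by rewrite (cocycleP _ _ _ FC) Fl0 Fr0 mul0r mulr0 subr0 add0r. Qed.

Variable H : arr Q -> Lam.

(* In the square-zero extension of Lam by itself defined by F, the product of
   the lifts (a, - H a) of the arrows of s has second component
   - cocycle_lift s. *)
Fixpoint cocycle_lift (s : seq (arr Q)) : Lam :=
  if s is a :: s' then
    ppi I (parr a) * cocycle_lift s' + H a * P s' - F (ppi I (parr a)) (P s')
  else 0.

Lemma arrows_prod_cat s s' : P (s ++ s') = P s * P s'.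
Proof. by rewrite /arrows_prod big_cat. Qed.

Lemma arrows_prod_cons a s : P (a :: s) = ppi I (parr a) * P s.
Proof. by rewrite /arrows_prod big_cons. Qed.

(** The lift of a concatenation is the product of the lifts; the induction step is associativity in
    the extension. *)
Lemma cocycle_lift_cat s s' : cocycle_lift (s ++ s') =
  P s * cocycle_lift s' + cocycle_lift s * P s' - F (P s) (P s').
Proof.
elim: s => [|a s IHs] /=.
  by rewrite /arrows_prod big_nil mul1r mul0r addr0 normal_1l subr0.
rewrite IHs arrows_prod_cat arrows_prod_cons.
exact: cocycle_mulA FC.
Qed.

Hypothesis Hl : forall a, e (src a) * H a = H a.
Hypothesis Hr : forall a, H a * e (tgt a) = H a.

Lemma cocycle_lift_l v s :
  composable v s -> e v * cocycle_lift s = cocycle_lift s.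
Proof.
case: s => [|a s] /=; first by rewrite mulr0.
case/andP=> /eqP <- _; apply: etrans (mulr_lstep _ _ _ _ _ _) _.
by rewrite Hl normal_l videm_l.
Qed.

Lemma cocycle_lift_r v s : composable v s ->
  cocycle_lift s * e (last v (map (@tgt Q) s)) = cocycle_lift s.
Proof.
elim: s v => [|a s IHs] v /=; first by rewrite mul0r.
case/andP=> _ cs; apply: etrans (mulr_rstep _ _ _ _ _ _) _.
rewrite (IHs _ cs) normal_r.
(* If [a] is the last arrow, the product over the rest is 1 and carries no end vertex; then the
   hypothesis on [H a] and the vanishing of F at vertices give the claim. *)
have [->|s0] := eqVneq s [::]; last by rewrite (arrows_prod_r I cs s0).
by rewrite /arrows_prod big_nil /= mul1r mulr1 Hr Fr0 normal_1r.
Qed.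

Definition path_lift : pathalg K Q -> Lam :=
  mlin (fun u : qpath Q => cocycle_lift (parrows u)).

Lemma path_lift_linear : linear path_lift.
Proof. exact: mlin_is_linear. Qed.

Lemma path_lift_basis u : path_lift (pbasis K u) = cocycle_lift (parrows u).
Proof. by rewrite pbasis.unlock /path_lift mlinU. Qed.

Lemma pend_vert (u : qpath Q) : parrows u = [::] -> pend u = pstart u.
Proof. by rewrite /pend => ->. Qed.

Lemma ppi_vert (u : qpath Q) : parrows u = [::] -> ppi I u = e (pstart u).
Proof.
move=> u0; congr ppi; apply: val_inj.
by rewrite [LHS]surjective_pairing /= -/(parrows u) u0.
Qed.

(** Multiplicativity of x |-> ([qpi I x], - [path_lift x]) into the extension. Both sides are
    bilinear in x and y, so paths suffice. *)
Lemma path_liftM x y : path_lift (x * y) =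
  qpi I x * path_lift y + path_lift x * qpi I y - F (qpi I x) (qpi I y).
Proof.
have qL := qpi_linear I.
have mB := mul_bilin Lam; have pB := mul_bilin (pathalg K Q).
have gL := path_lift_linear; have FB := FC.1.
have tB := twisted_bilin FB qL gL.
move: x; apply: pathalg_ext => [c a b||u]; [by rewrite pB.1 gL | exact: tB.1 |].
move: y; apply: pathalg_ext => [c a b||w]; [by rewrite pB.2 gL | exact: tB.2 |].
rewrite pbasisM !path_lift_basis -!/(ppi I _).
have lu : e (pstart u) * cocycle_lift (parrows u) = cocycle_lift (parrows u).
  exact: cocycle_lift_l (valP u).
have ru : cocycle_lift (parrows u) * e (pend u) = cocycle_lift (parrows u).
  exact: cocycle_lift_r (valP u).
have lw : e (pstart w) * cocycle_lift (parrows w) = cocycle_lift (parrows w).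
  exact: cocycle_lift_l (valP w).
case: eqP => [uw|/eqP/negPf uw]; last first.
  (* For non-composable paths, inserting the two orthogonal idempotents at the junction kills every
     term. *)
  have e0 : e (pend u) * e (pstart w) = 0 by rewrite videmM uw.
  have wE := videm_l I (erefl (pstart w)); have uE := videm_r I (erefl (pend u)).
  have -> : F (ppi I u) (ppi I w) = 0.
    by rewrite -uE normal_m -wE mulrA e0 mul0r (bilin0r FB).
  rewrite (mulr_orthogonal e0 uE lw) (mulr_orthogonal e0 ru wE) subr0 addr0.
  exact: linear0E gL.
rewrite path_lift_basis /parrows pcat_val //= -!/(parrows _).
(* Paths of length 0 are treated apart: their class is a vertex idempotent, whereas [arrows_prod] of
   the empty word is 1. *)
have [u0|u0] := eqVneq (parrows u) [::].
  rewrite (ppi_vert u0) u0 /= mul0r addr0 Fl0 subr0.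
  by rewrite -(pend_vert u0) uw lw.
have [w0|w0] := eqVneq (parrows w) [::].
  rewrite (ppi_vert w0) w0 cats0 /= mulr0 add0r Fr0 subr0.
  by rewrite -uw ru.
by rewrite cocycle_lift_cat (ppi_arrows_prod I u0) (ppi_arrows_prod I w0).
Qed.

(** The elements of I with zero lift form a two-sided ideal: in the product rule the terms
    containing the class of such an element vanish as well. *)
Lemma path_lift_ideal (X : set (pathalg K Q)) :
  ideal_gen X = [set` I] -> (forall x, X x -> path_lift x = 0) ->
  forall x, x \in I -> path_lift x = 0.
Proof.
move=> XI X0 x xI.
have FB := FC.1; have gL := path_lift_linear.
have qI y : y \in I -> qpi I y = 0.
  exact: qpi_ideal.
have XsubI y : X y -> y \in I.
  move=> Xy; have : [set` I] y by rewrite -XI; move=> S [_]; apply.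
  by [].
have xX : ideal_gen X x by rewrite XI.
suff [_ ->] : [set y | y \in I /\ path_lift y = 0] x by [].
apply: xX; split; last by move=> y Xy; split; [exact: XsubI | exact: X0].
have [I0 IB] := ideal_zmod I.
split=> [|y z [yI y0] [zI z0]|a y [yI y0]|a y [yI y0]] /=; split.
- exact: I0.
- exact: linear0E gL.
- exact: IB.
- by rewrite (linearBE _ _ gL) y0 z0 subr0.
- exact: ideal_mull.
- by rewrite path_liftM (qI _ yI) y0 mulr0 mulr0 (bilin0r FB) subr0 addr0.
- exact: ideal_mulr.
- by rewrite path_liftM (qI _ yI) y0 mul0r mul0r (bilin0l FB) subr0 addr0.
Qed.

(** A lift vanishing on I descends to the quotient, and the product rule, solved for F, exhibits F
    as the coboundary of the induced map. *)
Lemma path_lift_coboundary :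
  (forall x, x \in I -> path_lift x = 0) -> HH2_coboundary F.
Proof.
move=> I0; pose g (l : Lam) := path_lift (repr l).
have gpi x : g (qpi I x) = path_lift x.
  apply/eqP; rewrite -subr_eq0 -(linearBE _ _ path_lift_linear).
  apply/eqP/I0; rewrite -qpi_eqE; apply/eqP.
  exact: reprK.
move: g gpi => g gpi; exists g => [c a b|a b].
  have [x ->] := qpi_surj a; have [y ->] := qpi_surj b.
  apply: etrans (congr1 g (esym (qpi_linear I c x y))) _.
  by rewrite !gpi path_lift_linear.
have [x ->] := qpi_surj a; have [y ->] := qpi_surj b.
by rewrite /hoch_d1 qpiM !gpi path_liftM add_subK.
Qed.

End LiftOfCocycle.

(** * Vanishing of HH^2 from surjectivity of d_2 *)

Section HH2FromHom2.
Variables (K : fieldType) (Q : quiver) (I : alg_ideal (pathalg K Q)).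
Variable f2 : {fset uniform_elt K Q}.
Local Notation Lam := (quot_alg I).
Local Notation e v := (videm I v).

Lemma uniform_support (x : uniform_elt K Q) p :
  p \in msupp (uval x) -> pstart p = usrc x /\ pend p = utgt x.
Proof.
move=> px; have /forallP/(_ [` px]%fset)/= /andP[/eqP ps /eqP pe] := valP x.
by split.
Qed.

Lemma Hom1_A2_gen (h : Q1 I -> reg_bimod Lam) (x : f2) : Hom1 I h ->
  h (A2 (gen _ _ x : Q2 I f2)) =
  mlin (fun u : qpath Q => (h (A2_path I (parrows u)) : Lam)) (uval (val x)).
Proof.
case=> hL _ _; rewrite A2_gen (linear_sumE _ _ _ hL).
by apply: eq_bigr => p _; apply: linear_scaleE hL.
Qed.

Lemma reg_gen_lift_gen (m : f2 -> Lam) (x : f2) :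
  e (usrc (val x)) * m x = m x -> m x * e (utgt (val x)) = m x ->
  gen_lift (m : f2 -> reg_bimod Lam) (gen _ _ x : Q2 I f2) = m x.
Proof.
by move=> ml mr; rewrite gen_lift_gen -[RHS]mr -[in RHS]ml.
Qed.

Lemma mlin_uniform_l (k : qpath Q -> Lam) (x : uniform_elt K Q) :
  (forall u, e (pstart u) * k u = k u) ->
  e (usrc x) * mlin k (uval x) = mlin k (uval x).
Proof.
move=> kl; rewrite /mlin mulr_sumr !big_seq; apply: eq_bigr => u /uniform_support[us _].
by rewrite -scalerAr -us kl.
Qed.

Lemma mlin_uniform_r (k : qpath Q -> Lam) (x : uniform_elt K Q) :
  (forall u, k u * e (pend u) = k u) ->
  mlin k (uval x) * e (utgt x) = mlin k (uval x).
Proof.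
move=> kr; rewrite /mlin mulr_suml !big_seq; apply: eq_bigr => u /uniform_support[_ ue].
by rewrite -scalerAl -ue kr.
Qed.

(** The lift of a word is affine in the lifts of its arrows, and its linear part obeys the same
    Leibniz rule as h composed with A_2. *)
Lemma cocycle_lift_A2 (F : Lam -> Lam -> Lam) (h : Q1 I -> reg_bimod Lam) s :
  Hom1 I h ->
  cocycle_lift F (fun a => - h (gen _ _ a) : Lam) s =
  cocycle_lift F (fun=> 0) s - h (A2_path I s).
Proof.
move=> hH; elim: s => [|a s IHs] /=; first by rewrite (Hom1_A2_nil hH) subr0.
rewrite IHs (Hom1_A2_cons hH); exact: cocycle_step_sub.
Qed.

Lemma HH2_eq0_of_Hom2 :
  ideal_gen (@uval K Q @` [set` f2]) = [set` I] -> Hom2 I f2 `<=` Im_d2 I f2 ->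
  HH2_eq0 Lam.
Proof.
move=> genI sub f fC.
have [g gL [F [FC Fl Fr fF]]] := normalise (videmM I) (videm_sum I) fC.
suff [k kL Fk] : HH2_coboundary F.
  exists (fun x => g x + k x) => [c x y|a b]; last by rewrite hoch_d1D fF Fk.
  by rewrite gL kL scalerDr addrACA.
(* The uncorrected lifts (a, 0) of the arrows; [m x] below is then, up to sign, what the relation x
   lifts to. *)
pose H0 (a : arr Q) : Lam := 0.
have H0l a : e (src a) * H0 a = H0 a by rewrite mulr0.
have H0r a : H0 a * e (tgt a) = H0 a by rewrite mul0r.
pose m (x : f2) : Lam := path_lift F H0 (uval (val x)).
have mH : Hom2 I f2 (gen_lift (m : f2 -> reg_bimod Lam)).
  exact: gen_lift_hom.
have [h hH hm] := sub _ mH.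
(* With this sign, the correction subtracts the value of h A_2 at the generator of x, which is
   [m x], from the lift of x. *)
pose H (a : arr Q) : Lam := - h (gen _ _ a).
have Hl a : e (src a) * H a = H a.
  by rewrite mulrN (Hom1_gen_l hH).
have Hr a : H a * e (tgt a) = H a.
  by rewrite mulNr (Hom1_gen_r hH).
apply: (path_lift_coboundary FC Fl Fr Hl Hr).
apply: (path_lift_ideal FC Fl Fr Hl Hr genI) => _ [x xf2 <-].
pose y : f2 := [` xf2]%fset.
have my : h (A2 (gen _ _ y : Q2 I f2)) = m y.
  have := congr1 (fun k => k (gen _ _ y)) hm; rewrite /d2 /= => ->.
  apply: reg_gen_lift_gen.
    by apply: mlin_uniform_l => u; apply: cocycle_lift_l (valP u).
  by apply: mlin_uniform_r => u; apply: (cocycle_lift_r FC Fr H0r (valP u)).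
have := Hom1_A2_gen y hH; rewrite my /m /path_lift /mlin /= => mE.
rewrite /path_lift /mlin.
under eq_bigr do rewrite (cocycle_lift_A2 F _ hH) scalerBr.
apply: etrans (sumrB _ _ _ _) _; apply/eqP; rewrite subr_eq0; apply/eqP.
exact: mE.
Qed.

End HH2FromHom2.

(** * The length-lexicographic order realised in the natural numbers *)

Section LengthLexNumber.
Variables (Q : quiver) (leV : rel (vert Q)) (leA : rel (arr Q)).
Hypothesis leA_order : linear_order leA.
Implicit Types (s : seq (arr Q)) (u : qpath Q).

Let B := #|arr Q|.+1.
Let rank (a : arr Q) := #|[pred b | leA b a]|.

(* The arrows are the nonzero digits in base B, so that a longer word is a
   larger number. *)
Fixpoint word_num s : nat :=
  if s is a :: s' then (rank a * B ^ size s' + word_num s')%N else 0%N.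

Let rank_gt0 a : (0 < rank a)%N.
Proof. by case: leA_order => r _ _ _; apply/card_gt0P; exists a; rewrite inE. Qed.

Let rank_lt a b : leA a b -> a != b -> (rank a < rank b)%N.
Proof.
case: leA_order => r asym tr _ ab nab; apply: proper_card; apply/properP; split.
  by apply/fintype.subsetP => c; rewrite !inE => /tr; apply.
exists b; rewrite !inE //; apply: contra nab => ba.
by apply/eqP/asym; rewrite ab ba.
Qed.

Lemma word_num_lt s : (word_num s < B ^ size s)%N.
Proof.
elim: s => //= a s IHs; rewrite expnS.
apply: (@leq_trans (rank a * B ^ size s + B ^ size s)%N); first by rewrite ltn_add2l.
by rewrite addnC -mulSn leq_mul2r ltnS max_card orbT.
Qed.

Lemma word_num_size s s' : (size s < size s')%N -> (word_num s < word_num s')%N.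
Proof.
case: s' => //= a s'; rewrite ltnS => ss'; apply: leq_trans (word_num_lt s) _.
apply: leq_trans (leq_addr _ _); apply: (@leq_trans (B ^ size s')%N).
  by rewrite leq_exp2l // ltnS; apply/card_gt0P; exists a.
by rewrite leq_pmull.
Qed.

Lemma word_num_lex s s' : size s = size s' -> lexle leA s s' -> s != s' ->
  (word_num s < word_num s')%N.
Proof.
elim: s s' => [|a s IHs] [|b s'] //= [ss']; rewrite eqseq_cons ss'.
have [-> /= ls ns|ab lab _] := eqVneq a b; first by rewrite ltn_add2l IHs.
apply: (@leq_trans (rank a * B ^ size s' + B ^ size s')%N).
  by rewrite ltn_add2l -ss' word_num_lt.
apply: leq_trans (leq_addr _ _).
by rewrite addnC -mulSn leq_mul2r rank_lt ?orbT.
Qed.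

(** Makes descent along the order an induction on natural numbers. A path is recovered from its word
    once its start is fixed, so distinct paths here have distinct words. *)
Lemma path_le_num u u' : pstart u = pstart u' -> Defs.path_le leV leA u u' ->
  u != u' -> (word_num (parrows u) < word_num (parrows u'))%N.
Proof.
move=> us; rewrite /Defs.path_le => /orP[/word_num_size //|/andP[/eqP uu']].
have E : parrows u = parrows u' -> u = u'.
  move=> pu; apply: val_inj; rewrite [val u]surjective_pairing.
  by rewrite [val u']surjective_pairing -!/(parrows _) -!/(pstart _) us pu.
case: ifP => [/eqP u0 _|_ uu'le] nuu'.
  case/eqP: nuu'; apply: E; move: uu'; rewrite u0 => /esym/size0nil ->.
  exact: size0nil.
apply: word_num_lex => //; apply: contra nuu' => /eqP/E ->; exact: eqxx.
Qed.

End LengthLexNumber.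

(** * Parallel paths modulo I when there is a single non-tip *)

Section ParallelPaths.
Variables (K : fieldType) (Q : quiver) (I : alg_ideal (pathalg K Q)).
Variables (leV : rel (vert Q)) (leA : rel (arr Q)).
Hypothesis leA_order : linear_order leA.
Local Notation Lam := (quot_alg I).
Local Notation e v := (videm I v).

Lemma qpi_mlin x : qpi I x = mlin (ppi I) x.
Proof.
move: x; apply: pathalg_ext => [||u]; first exact: qpi_linear.
  exact: mlin_is_linear.
by rewrite -/(ppi I u) pbasis.unlock mlinU.
Qed.

Lemma videm_ppi_videm v w u : e v * ppi I u * e w =
  if (pstart u == v) && (pend u == w) then ppi I u else 0.
Proof.
have [<-|uv] /= := eqVneq (pstart u) v; last first.
  by rewrite -(videm_l I (erefl (pstart u))) mulrA videmM eq_sym (negPf uv) !mul0r.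
rewrite (videm_l I (erefl (pstart u))); have [<-|uw] := eqVneq (pend u) w.
  exact: videm_r.
by rewrite -(videm_r I (erefl (pend u))) -mulrA videmM (negPf uw) mulr0.
Qed.

Lemma videm_qpi_videm v w x : e v * qpi I x * e w =
  \sum_(u <- msupp x | (pstart u == v) && (pend u == w)) x@_u *: ppi I u.
Proof.
rewrite qpi_mlin /mlin mulr_sumr mulr_suml [RHS]big_mkcond /=; apply: eq_bigr => u _.
by rewrite -scalerAr -scalerAl videm_ppi_videm; case: ifP => // _; rewrite scaler0.
Qed.

Definition multiple (l0 l : Lam) : Prop := exists c : K, l = c *: l0.

Lemma multiple_sum l0 (s : seq (qpath Q)) (P : pred (qpath Q)) (c : qpath Q -> K) k :
  (forall u, u \in s -> P u -> multiple l0 (k u)) ->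
  multiple l0 (\sum_(u <- s | P u) c u *: k u).
Proof.
move=> kP; rewrite big_seq_cond; apply: big_ind => [|_ _ [b ->] [d ->]|u].
- by exists 0; rewrite scale0r.
- by exists (b + d); rewrite scalerDl.
by case/andP=> us Pu; have [d ->] := kP u us Pu; exists (c u * d); rewrite scalerA.
Qed.

(* A path which is not [p] is a tip, hence modulo I a combination of smaller
   parallel paths. *)
Lemma ppi_multiple v w p u : vNonTip leV leA I v w = [set p] ->
  pstart u = v -> pend u = w -> multiple (ppi I p) (ppi I u).
Proof.
move=> vwp; have [n] := ubnP (word_num leA (parrows u)).
elim: n u => // n IHn u; rewrite ltnS => un uv uw.
have [[x [xI _ [ux xle]]]|ntip] := pselect (Tip leV leA I u); last first.
  have : vNonTip leV leA I v w u by split.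
  by rewrite vwp => ->; exists 1; rewrite scale1r.
(* x need not be uniform: multiplying by v and w keeps only its part parallel to u, which is again
   zero modulo I. *)
have := videm_qpi_videm v w x; rewrite (qpi_ideal xI) mulr0 mul0r.
rewrite (big_rem u ux) uv uw !eqxx /=.
set rest := bigop _ _ _ => /eqP; rewrite eq_sym addr_eq0 => /eqP xu.
have [c restE] : multiple (ppi I p) rest.
  apply: multiple_sum => u'; rewrite (mem_rem_uniq _ (fset_uniq _)).
  case/andP=> nu'u u'x /andP[/eqP u'v /eqP u'w].
  apply: IHn => //; apply: leq_trans un.
  apply: (path_le_num leA_order) (xle _ u'x) nu'u.
  by rewrite u'v uv.
(* Solve for u, dividing by its coefficient in x, nonzero because u is the tip of x. *)
exists (- ((x@_u)^-1 * c)); rewrite scaleNr -scalerA -restE -scalerN -xu scalerA.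
by rewrite mulVf ?scale1r // mcoeff_neq0.
Qed.

Lemma vLamw_multiple v w p l : vNonTip leV leA I v w = [set p] ->
  multiple (ppi I p) (e v * l * e w).
Proof.
move=> vwp; have [x ->] := qpi_surj l; rewrite videm_qpi_videm.
by apply: multiple_sum => u _ /andP[/eqP uv /eqP uw]; apply: ppi_multiple vwp uv uw.
Qed.

End ParallelPaths.

(** * Homomorphisms on [Q1] given by weights on the arrows *)

Section WeightedHom.
Variables (K : fieldType) (Q : quiver) (I : alg_ideal (pathalg K Q)).
Local Notation Lam := (quot_alg I).
Variable w : arr Q -> K.

Definition weight_hom : Q1 I -> reg_bimod Lam :=
  gen_lift (fun b => (w b *: ppi I (parr b) : Lam) : reg_bimod Lam).

Lemma weight_hom1 : Hom1 I weight_hom.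
Proof. exact: gen_lift_hom. Qed.

Lemma weight_hom_gen b :
  weight_hom (gen _ _ b) = w b *: ppi I (parr b) :> Lam.
Proof.
rewrite /weight_hom gen_lift_gen.
by apply: mulr_scale_sandwich; [apply: videm_l | apply: videm_r].
Qed.

(** Each term of A_2 removes one arrow b, and the homomorphism puts it back with factor [w b]; every
    term thus restores the word, and the weights add up. *)
Lemma weight_hom_A2 s : weight_hom (A2_path I s) =
  (\sum_(b <- s) w b) *: arrows_prod I s :> Lam.
Proof.
elim: s => [|b s IHs].
  by rewrite (Hom1_A2_nil weight_hom1) big_nil scale0r.
apply: etrans (Hom1_A2_cons weight_hom1 _ _) _.
by rewrite weight_hom_gen IHs big_cons arrows_prod_cons scalerDl scalerAl scalerAr.
Qed.

End WeightedHom.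

(** * Minimal relations and values on the generators of [Q2] *)

Section Hom2Values.
Variables (K : fieldType) (Q : quiver) (I : alg_ideal (pathalg K Q)).
Variable f2 : {fset uniform_elt K Q}.
Local Notation Lam := (quot_alg I).

(** A zero element could be removed from f^2 without changing the ideal, against minimality. *)
Lemma minimal_generating_neq0 (x : uniform_elt K Q) :
  minimal_generating_set I f2 -> x \in f2 -> uval x != 0.
Proof.
move=> [genI minI] xf2; apply/eqP => x0.
apply: (minI (f2 `\ x)%fset); first exact: fproperD1.
rewrite -genI; apply/seteqP; split=> y yS S [SI Ssub]; apply: yS; split=> //.
  move=> _ [z /= zf2 <-]; apply: Ssub; exists z => //=.
  by move: zf2; rewrite !inE => /andP[].
move=> _ [z /= zf2 <-]; have [->|zx] := eqVneq z x; first by rewrite x0; case: SI.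
by apply: Ssub; exists z => //=; rewrite !inE zx.
Qed.

(** The generator indexed by x is fixed by o(x) and t(x), so its image lies in the block between
    these vertices. *)
Lemma Hom2_gen (k : Q2 I f2 -> reg_bimod Lam) (x : f2) : Hom2 I f2 k ->
  k (gen _ _ x) = videm I (usrc (val x)) * k (gen _ _ x) * videm I (utgt (val x)) :> Lam.
Proof.
move=> kH; have gE : gen _ _ x = ract (lact (videm I (usrc (val x))) (gen _ _ x : Q2 I f2))
    (videm I (utgt (val x))) :> Q2 I f2.
  apply/ffunP => y; rewrite !ffunE; have [<-|xy] := eqVneq x y; last first.
    by rewrite !dfwith_out // (bilin0r lactB) (bilin0l ractB).
  rewrite !dfwith_in; apply/esym.
  apply: etrans (congr1 (fun z => pract z _) (plact_pure _ _ _)) _.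
  apply: etrans (pract_pure _ _ _) _.
  by congr pure; apply: val_inj; rewrite /= ?mul1r ?mulr1 videmM eqxx.
case: kH => _ kl kr; rewrite [in LHS]gE.
by apply: etrans (kr _ _) _; congr (_ * _); apply: kl.
Qed.

End Hom2Values.

(** * Differences of two paths *)

Section Binomial.
Variables (K : fieldType) (Q : quiver).
Implicit Types u v : qpath Q.

Lemma mlin_binomial (W : lmodType K) (k : qpath Q -> W) u v :
  mlin k (pbasis K u - pbasis K v) = k u - k v.
Proof.
apply: etrans (linearBE _ _ (mlin_is_linear k)) _.
by rewrite pbasis.unlock; congr (_ - _); apply: mlinU.
Qed.

Lemma mcoeff_pbasis u v : (pbasis K u)@_v = (u == v)%:R.
Proof. by rewrite pbasis.unlock mcoeffU. Qed.

(** As u and v differ, v survives in x with coefficient -1, and uniformity of x applies to it. *)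
Lemma binomial_support u v (x : uniform_elt K Q) :
  uval x = pbasis K u - pbasis K v -> u != v ->
  pstart v = usrc x /\ pend v = utgt x.
Proof.
move=> xE uv; apply: uniform_support; rewrite xE -mcoeff_neq0.
have -> : (pbasis K u - pbasis K v)@_v = (u == v)%:R - (v == v)%:R.
  by apply: etrans (mcoeffB _ _ _) _; congr (_ - _); apply: mcoeff_pbasis.
by rewrite eqxx (negPf uv) sub0r oppr_eq0 oner_eq0.
Qed.

End Binomial.

(** * Every homomorphism on [Q2] is a coboundary *)

Section Coboundaries.
Variables (K : fieldType) (Q : quiver) (I : alg_ideal (pathalg K Q))
    (f2 : {fset uniform_elt K Q}) (leV : rel (vert Q)) (leA : rel (arr Q)).
Hypotheses
    (gen_I : minimal_generating_set I f2)
    (leA_order : linear_order leA)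
    (binomials : forall v w, Bdy f2 (v, w) -> vLamw I v w <> [set 0] ->
       exists (p : qpath Q) (qs : seq (qpath Q)),
         vNonTip leV leA I v w = [set p] /\
         f2_between f2 v w = [set pbasis K p - pbasis K q | q in [set` qs]]).
Variables
    (r : nat) (p : 'I_r -> qpath Q)
    (t : 'I_r -> nat) (q : forall i : 'I_r, 'I_(t i) -> qpath Q).
Hypotheses
    (G2_eq : G2 leV leA I f2 = range p)
    (q_eq : forall i, f2_between f2 (pstart (p i)) (pend (p i)) =
       [set pbasis K (p i) - pbasis K (q j) | j in [set: 'I_(t i)]]).
Variable a : forall i : 'I_r, 'I_(t i) -> arr Q.
Hypotheses
    (a_assoc : forall i j, associated_arrow (all_paths p q) (q j) (a (i := i) j))
    (a_once : forall i j, count_mem (a (i := i) j) (parrows (q j)) = 1%N).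
Local Notation Lam := (quot_alg I).

(** The second clause prevents the cancellation that would hide the ends of [q j]; the last one
    makes [p i] determined by the ends of x. *)
Let binomial_at (x : f2) i (j : 'I_(t i)) : Prop :=
  [/\ uval (val x) = pbasis K (p i) - pbasis K (q j), p i != q j,
      pstart (p i) = usrc (val x) /\ pend (p i) = utgt (val x) &
      vNonTip leV leA I (usrc (val x)) (utgt (val x)) = [set p i]].

(** The single non-tip of the block belongs to G^2, hence is some [p i], and the list of relations
    at i provides j. If [p i] were [q j], the relation would be zero. *)
Let binomialP (x : f2) : vLamw I (usrc (val x)) (utgt (val x)) <> [set 0] ->
  exists i j, @binomial_at x i j.
Proof.
move=> n0; have bx : Bdy f2 (usrc (val x), utgt (val x)).
  by exists (val x) => //=; apply: valP.
have [p0 [_ [NT _]]] := binomials bx n0.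
have ntp : vNonTip leV leA I (usrc (val x)) (utgt (val x)) p0 by rewrite NT.
have [i _ pi] : range p p0 by rewrite -G2_eq; exists (usrc (val x), utgt (val x)).
subst p0; have [_ ps pe] := ntp.
have : f2_between f2 (pstart (p i)) (pend (p i)) (uval (val x)).
  by exists (val x) => //=; split; rewrite ?ps ?pe //; apply: valP.
rewrite q_eq => -[j _ xE]; exists i, j; split=> //.
apply/eqP => pq; have /eqP := minimal_generating_neq0 gen_I (valP x); apply.
by rewrite -xE pq subrr.
Qed.

Let binomial_ends x i (j : 'I_(t i)) : binomial_at x j ->
  pstart (q j) = usrc (val x) /\ pend (q j) = utgt (val x).
Proof. by case=> xE pq _ _; apply: binomial_support xE pq. Qed.

(** If [q j] were some [p i'], it would be a non-tip with the ends of x, hence [p i] itself. *)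
Let binomial_notin_p x i (j : 'I_(t i)) i' :
  binomial_at x j -> a j \notin parrows (p i').
Proof.
move=> xij; have [qs qe] := binomial_ends xij; case: xij => xE pq _ NT.
apply: (a_assoc j).2; first by left; exists i'.
move=> pq'; have [vw _ [ntp _ _]] : G2 leV leA I f2 (p i') by rewrite G2_eq; exists i'.
have : vNonTip leV leA I (usrc (val x)) (utgt (val x)) (p i').
  by split; rewrite // pq'.
by rewrite NT => pp; case/eqP: pq; rewrite -pq'.
Qed.

(** Equal paths [q j] and [q j'] have equal ends, hence equal partners [p i] and [p i'], and so come
    from one relation. Distinctness is asked of the relations because the indexing may repeat a
    path. *)
Let binomial_notin_q x i (j : 'I_(t i)) x' i' (j' : 'I_(t i')) :
  binomial_at x j -> binomial_at x' j' -> x != x' -> a j \notin parrows (q j').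
Proof.
move=> xij xij' xx'; apply: (a_assoc j).2; first by right; exists i', j'.
move=> qq; case/eqP: xx'; apply/val_inj.
have [qs qe] := binomial_ends xij; have [qs' qe'] := binomial_ends xij'.
have ss : usrc (val x) = usrc (val x') by rewrite -qs -qs' qq.
have ee : utgt (val x) = utgt (val x') by rewrite -qe -qe' qq.
case: xij xij' => xE _ _ NT [xE' _ _ NT'].
have pp : p i = p i'.
  by have : [set p i] (p i') by rewrite -NT ss ee NT'.
have uu : uval (val x) = uval (val x') by rewrite xE xE' pp qq.
apply: val_inj; rewrite [val (val x)]surjective_pairing.
rewrite [val (val x')]surjective_pairing; congr (_, _); first exact: uu.
rewrite [(val (val x)).2]surjective_pairing.
by rewrite [(val (val x')).2]surjective_pairing; congr (_, _).
Qed.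

Lemma Hom2_sub_Im_d2 : Hom2 I f2 `<=` Im_d2 I f2.
Proof.
move=> k kH.
(* Each relation gets its own weight function, supported on its associated arrow; the sign is that
   of q_ij in p_i - q_ij. *)
have spec (x : f2) : exists W : arr Q -> K,
    (vLamw I (usrc (val x)) (utgt (val x)) = [set 0] /\ W = fun=> 0) \/
    exists i (j : 'I_(t i)) c, [/\ binomial_at x j,
      k (gen _ _ x) = c *: ppi I (p i) :> Lam &
      W = fun b => if b == a j then - c else 0].
  have [v0|v0] := pselect (vLamw I (usrc (val x)) (utgt (val x)) = [set 0]).
    by exists (fun=> 0); left.
  have [i [j xij]] := binomialP v0; have [_ _ _ NT] := xij.
  have [c kE] := vLamw_multiple leA_order (k (gen _ _ x) : Lam) NT.
  exists (fun b => if b == a j then - c else 0); right; exists i, j, c; split=> //.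
  by rewrite (Hom2_gen x kH).
have [W WP] := choice spec.
(* All prescriptions are superposed: along the paths of a relation x, only the summand of x
   contributes. *)
pose w b := \sum_x W x b.
have sum_w s : \sum_(b <- s) w b = \sum_x \sum_(b <- s) W x b.
  by rewrite exchange_big.
have sum_W (c : K) b (s : seq (arr Q)) :
    \sum_(b' <- s) (if b' == b then - c else 0) = - c *+ count_mem b s.
  elim: s => [|b' s IHs]; first by rewrite big_nil.
  by rewrite big_cons IHs /=; case: (b' == b); rewrite ?add0r //= add1n mulrS.
have sum_W0 x s : (forall i (j : 'I_(t i)), binomial_at x j -> a j \notin s) ->
    \sum_(b <- s) W x b = 0.
  move=> notin; have [[_ ->]|[i [j [c [xij _ ->]]]]] := WP x; first by rewrite big1.
  by rewrite sum_W (count_memPn (notin _ _ xij)).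
exists (weight_hom (I := I) w); first exact: weight_hom1.
have dH : Hom2 I f2 (d2 (weight_hom (I := I) w)).
  have [AL Al Ar] := A2_hom I f2; have [hL hl hr] := weight_hom1 I w.
  split=> [c y z|l y|y l]; rewrite /d2 /=.
  - by rewrite AL hL.
  - by rewrite Al hl.
  - by rewrite Ar hr.
apply: (gen_hom_ext dH kH) => x.
have [[v0 _]|[i [j [c [xij kE WE]]]]] := WP x.
  (* In a zero block every homomorphism vanishes on the generator. *)
  have gen0 k' : Hom2 I f2 k' -> k' (gen _ _ x) = 0 :> Lam.
    move=> k'H; have : vLamw I (usrc (val x)) (utgt (val x)) (k' (gen _ _ x)).
      by exists (k' (gen _ _ x)) => //; rewrite -Hom2_gen.
    by rewrite v0.
  by rewrite (gen0 _ dH) (gen0 _ kH).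
have [xE pq _ _] := xij.
have w_p : \sum_(b <- parrows (p i)) w b = 0.
  rewrite sum_w big1 // => y _; apply: sum_W0 => i' j' yij'.
  exact: binomial_notin_p yij'.
have w_q : \sum_(b <- parrows (q j)) w b = - c.
  rewrite sum_w (bigD1 x) //= [X in _ + X]big1 => [|y yx].
    by rewrite WE sum_W a_once mulr1n addr0.
  by apply: sum_W0 => i' j' yij'; apply: binomial_notin_q yij' xij yx.
apply: etrans (Hom1_A2_gen x (weight_hom1 I w)) _.
rewrite xE mlin_binomial !weight_hom_A2 w_p w_q scale0r sub0r scaleNr opprK.
rewrite [RHS]kE; congr (_ *: _).
(* [q j] contains an arrow, so [arrows_prod] gives its class, which equals that of [p i] because
   their difference is a relation. *)
have q0 : parrows (q j) != [::].
  by apply/eqP => q0; have := a_once j; rewrite q0.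
rewrite -(ppi_arrows_prod I q0); apply/esym/eqP.
rewrite qpi_eqE -xE; have [genI _] := gen_I.
have : [set` I] (uval (val x)); last by [].
by rewrite -genI => S [_]; apply; exists (val x) => //=; apply: valP.
Qed.

End Coboundaries.

Unset Implicit Arguments.
Set Strict Implicit.

Theorem theorem3p6 (K : fieldType) (Q : quiver) (I : alg_ideal (pathalg K Q))
    (f2 : {fset uniform_elt K Q}) (leV : rel (vert Q)) (leA : rel (arr Q))
    (fin_Lam : finite_dimensional (quot_alg I))
    (adm_I : admissible I)
    (gen_I : minimal_generating_set I f2)
    (leV_order : linear_order leV) (leA_order : linear_order leA)
    (one_path : forall v w, Bdy f2 (v, w) ->
       vLamw I v w = [set 0] \/
       exists p, vNonTip leV leA I v w = [set p])
    (binomials : forall v w, Bdy f2 (v, w) -> vLamw I v w <> [set 0] ->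
       exists (p : qpath Q) (qs : seq (qpath Q)),
         vNonTip leV leA I v w = [set p] /\
         f2_between f2 v w = [set pbasis K p - pbasis K q | q in [set` qs]])
    (r : nat) (p : 'I_r -> qpath Q)
    (t : 'I_r -> nat) (q : forall i : 'I_r, 'I_(t i) -> qpath Q)
    (G2_eq : G2 leV leA I f2 = range p)
    (q_eq : forall i, f2_between f2 (pstart (p i)) (pend (p i)) =
       [set pbasis K (p i) - pbasis K (q i j) | j in [set: 'I_(t i)]])
    (L0_Y : L0 (all_paths p q) = all_paths p q)
    (a : forall i : 'I_r, 'I_(t i) -> arr Q)
    (a_assoc : forall i j, associated_arrow (all_paths p q) (q i j) (a i j))
    (a_once : forall i j, count_mem (a i j) (parrows (q i j)) = 1%N) :
  [/\ Hom2 I f2 `<=` Im_d2 I f2,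
      (forall (p0 : qpath Q) (x : f2), G2 leV leA I f2 p0 ->
         usrc (val x) = pstart p0 -> utgt (val x) = pend p0 ->
         Im_d2 I f2 (phi I p0 x))
    & HH2_eq0 (quot_alg I)].
Proof.
have sub := Hom2_sub_Im_d2 gen_I leA_order binomials G2_eq q_eq a_assoc a_once.
split=> // [p0 x _ _ _|]; first by apply: sub; apply: phi_hom.
exact: HH2_eq0_of_Hom2 gen_I.1 sub.
Qed.
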